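(* Let $G = (A_5\times A_5 \times A_5).6$. The covering number of $G$ is $\sigma(G) = 1127$.
   Context: A finite cover of a group $G$ is a finite collection $\mathcal{C}$ of proper subgroups of $G$ with $\bigcup \mathcal{C} = G$. If $G$ admits a finite cover, the covering number $\sigma(G)$ is the smallest cardinality of a finite cover of $G$. The group $(A_5\times A_5\times A_5).6$ is the primitive permutation group of degree $125$ and order $1296000$ with socle $A_5\times A_5\times A_5$ and cyclic quotient of order $6$ by its socle. Concretely, it is the subgroup of the wreath product $S_5 \ \mathrm{wr}\ S_3 = (S_5\times S_5\times S_5)\rtimes S_3$ (with $S_3$ permuting the three coordinates) consisting of all elements $(a,b,c)\pi$ with $a,b,c\in S_5$, $\operatorname{sgn}(a)=\operatorname{sgn}(b)=\operatorname{sgn}(c)$, and $\pi \in A_3$. *)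

(* Defs.v *)
From HB Require Import structures.
From mathcomp Require Import all_boot all_fingroup all_solvable.

Set Implicit Arguments.
Unset Strict Implicit.
Unset Printing Implicit Defensive.

Local Open Scope group_scope.

Definition is_cover (gT : finGroupType) (G : {group gT})
    (C : {set {group gT}}) : bool :=
  [forall (H : {group gT} | H \in C), H \proper G]
    && (\bigcup_(H in C) H == G :> {set gT}).

(* [arg min] returns its default set0 only when no cover exists (G cyclic).
   The empty family is never a cover, so the value 0 means "no cover". *)
Definition covering_number (gT : finGroupType) (G : {group gT}) : nat :=
  #|[arg min_(C < set0 | is_cover G C) #|C|]|.

Lemma covering_numberP (gT : finGroupType) (G : {group gT}) (n : nat) :
  0 < n ->
  covering_number G = n <->
    (exists2 C, is_cover G C & #|C| = n)
      /\ (forall C, is_cover G C -> n <= #|C|).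
Proof.
move=> n_gt0; rewrite /covering_number /arg_min /extremum.
case: pickP => [C /andP[covC /'forall_implyP/= minC] | noC] /=.
  split=> [<- | [[C' covC' <-] min']]; first by split=> //; exists C.
  by apply/eqP; rewrite eqn_leq minC //= min'.
rewrite cards0; split=> [n0 | [[C covC defn] minn]].
  by rewrite -n0 in n_gt0.
have /negP[] := noC C; apply/andP; split=> //.
by apply/'forall_implyP=> C' covC' /=; rewrite defn minn.
Qed.

(* The base group S_5 x S_5 x S_5, with the direct product group law. *)
Notation S5cube := {dffun forall _ : 'I_3, 'S_5}.

(* MathComp permutations compose left to right, whence the inverse. *)
Definition permute_coords (x : S5cube) (p : 'S_3) : S5cube :=
  [ffun i => x (p^-1 i)].

Lemma permute_coords_is_action : is_action [set: 'S_3] permute_coords.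
Proof.
split=> [p x y /ffunP exy | x p q _ _].
  by apply/ffunP=> i; move: (exy (p i)); rewrite !ffunE permK.
by apply/ffunP=> i; rewrite !ffunE invMg permM.
Qed.

Canonical permute_coords_action := Action permute_coords_is_action.

Lemma permute_coords_is_groupAction :
  is_groupAction [set: S5cube] permute_coords_action.
Proof.
move=> p _; rewrite inE; apply/andP; split.
  by apply/subsetP=> x _; rewrite inE.
by apply/morphicP=> x y _ _; rewrite !actpermE; apply/ffunP=> i; rewrite !ffunE.
Qed.

Canonical permute_coords_groupAction :=
  GroupAction permute_coords_is_groupAction.

(* An element u has top component u.1 : 'S_3 and base component u.2; it is the
   product sdpair2 u.1 * sdpair1 u.2, with the top factor on the left. *)
Definition S5_wr_S3 : finGroupType := sdprod_by permute_coords_groupAction.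

(* The elements (a, b, c)pi with sgn a = sgn b = sgn c and pi in A_3: both
   conditions are unaffected by which side the top factor is written on. *)
Definition A5cube6_set : {set S5_wr_S3} :=
  [set u : S5_wr_S3 | (u.1 \in 'Alt_('I_3))
     && [forall i, forall j, odd_perm (u.2 i) == odd_perm (u.2 j)]].

Lemma A5cube6_group_set : group_set A5cube6_set.
Proof.
apply/group_setP; split=> [|u v].
  rewrite in_set group1 /=; apply/'forall_forallP=> i j.
  by rewrite !ffunE !odd_perm1.
rewrite in_set => /andP[u1 /'forall_forallP u2].
rewrite in_set => /andP[v1 /'forall_forallP v2].
rewrite in_set; apply/andP; split; first exact: (groupM u1 v1).
apply/'forall_forallP=> i j.
by rewrite !ffunE !odd_permM (eqP (u2 _ (v.1^-1 j))) (eqP (v2 i j)).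
Qed.

Canonical A5cube6 : {group S5_wr_S3} := Group A5cube6_group_set.

(* Main.v *)
Require Import Defs.
From mathcomp Require Import all_boot all_fingroup all_solvable.
From mathcomp Require Import zify.

(** Let N be the socle A5^3, so that G / N is cyclic of order six.  An element
    of G generates G / N exactly when it rotates the three coordinates and its
    coordinates are odd.  If g rotates, say by [rot3], then coordinate 0 of
    g^3, called here the return of g, is the product in cyclic order of the
    three coordinates of g.  Whenever S5 acts on X, a triple over X is fixed
    by g as soon as its entry at 0 is fixed by the return, and the other two
    entries are then transported from the first.

    A cover of size 2 + 5^3 + 10^3: the two normal subgroups of index 2 and 3
    contain every element that does not generate G / N, and the return of any
    other element is an odd permutation of five points, hence fixes a point or
    a 2-subset, so the element lies in the stabiliser of a triple of points
    (5^3 of them) or of a triple of 2-subsets (10^3 of them)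
    ([small_coverP], [odd_in_stabiliser]).

    No cover is smaller.  By [trichotomy], a proper subgroup H that contains a
    generator of G / N fixes a triple of points, of 2-subsets or of Sylow
    5-subgroups of S5, or is diagonal: H meets N in a copy of A5 on which every
    coordinate is injective.  This is Goursat's lemma
    ([socle_sub_or_separating]) together with the list of the subgroups of S5
    ([subgroup_S5]).

    - For each triple t of 2-subsets, some element whose return has order 6
      lies in no proper subgroup but those that fix t, and fixes no other
      triple of 2-subsets ([pair_witness]).  This forces 1000 members, all of
      them inside stabilisers of triples of 2-subsets.
    - For each of the 216 triples v of Sylow 5-subgroups there are 1000
      generators of G / N that fix v and have top component [rot3].  Their
      returns are 4-cycles, so that none of them is in a member of the first
      kind.  A subgroup that fixes a triple of points, or a triple of
      Sylow 5-subgroups other than v, contains at most 8 of them.  A diagonal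
      subgroup has at most 60 elements in the coset, each of which fixes at
      most six triples v.  Assign to each member that fixes Sylow triples one
      such triple; summing over the triples v that are not assigned shows that
      at least 1000 / 8 = 125 members of a second kind are needed
      ([odd_cover_bound]).
    - The element [u0], with coordinates of orders 4, 6, 6, lies in no member
      of either kind ([u0_type], [u0_pair_type]), and the member that contains
      it has no generator of G / N.
    - If that were the only other member, the elements with top component
      [rot3], even coordinates and a 5-cycle as return would all be in the 125
      members of the second kind, which are too small for that
      ([even_cover_bound]).

    So a cover has at least 1000 + 125 + 2 members ([cover_bound]). *)

Set Implicit Arguments.
Unset Strict Implicit.
Unset Printing Implicit Defensive.
Local Open Scope group_scope.

Local Notation S5 := [set: {perm 'I_5}].
Local Notation A5 := 'Alt_('I_5).

(** * The groups S5 and A5 and their Sylow 5-subgroups *)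

Lemma card_S5 : #|S5| = 120.
Proof. by have := card_Sym 'I_5; rewrite card_ord. Qed.

Lemma card_A5 : #|A5| = 60.
Proof.
have := @card_Alt 'I_5; rewrite card_ord => /(_ isT) /eqP.
by rewrite (_ : 5`! = 2 * 60)%N // eqn_pmul2l // => /eqP.
Qed.

Lemma simple_A5 : simple A5.
Proof. by apply: simple_Alt5; rewrite card_ord. Qed.

Lemma A5_sub_normalised (M : {group {perm 'I_5}}) :
  A5 \subset 'N(M) -> M :&: A5 != 1 -> A5 \subset M.
Proof.
move=> nMA; have [_ simA] := simpleP _ simple_A5.
have nIA : (M :&: A5)%G <| A5 by rewrite /normal subsetIr normsI ?normG.
by case: (simA _ nIA) => /= [-> /eqP // | /setIidPr].
Qed.

Lemma der_A5 : A5^`(1) = A5.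
Proof.
have [ntA simA] := simpleP _ simple_A5.
have [//= /derG1P /abelian_sol solA | //] := simA _ (der_normal 1 A5).
by have := @solvable_AltF 'I_5; rewrite card_ord solA => /(_ isT).
Qed.

(** The number of Sylow 5-subgroups is 1 modulo 5 and divides 120. *)
Lemma card_Syl5_mod (gT : finGroupType) (G : {group gT}) :
  #|G| %| 120 -> #|'Syl_5(G)| = 1%N \/ #|'Syl_5(G)| = 6.
Proof.
move=> dvG; have := card_Syl_mod G (isT : prime 5).
have := dvdn_trans (card_Syl_dvd 5 G) dvG.
rewrite dvdn_divisors //; move: #|_| => n.
by rewrite !inE; repeat (case/orP => [/eqP->//|]); try (move/eqP->); auto.
Qed.

Lemma expn5_Alt (x : {perm 'I_5}) : x ^+ 5 = 1 -> x \in A5.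
Proof.
move=> x5; rewrite Alt_even; move: (congr1 (fun y : {perm _} => odd_perm y) x5).
by rewrite !expgS expg0 !odd_permM odd_perm1; case: (odd_perm x).
Qed.

(** Elements of odd order are even permutations. *)
Lemma card5_sub_Alt (P : {group {perm 'I_5}}) : #|P| = 5 -> P \subset A5.
Proof.
move=> oP; apply/subsetP=> x Px; apply: expn5_Alt.
by have := expg_cardG Px; rewrite oP.
Qed.

Lemma card5_Sylow (G P : {group {perm 'I_5}}) :
  P \subset G -> #|P| = 5 -> 5.-Sylow(G) P.
Proof.
move=> sPG oP; have sylS : 5.-Sylow(S5) P.
  by rewrite pHallE subsetT card_S5 oP p_part; vm_compute.
exact: pHall_subl sPG (subsetT _) sylS.
Qed.

(** Since 25 does not divide 120, the 5-part of the order is 5. *)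
Lemma Sylow5_card (G P : {group {perm 'I_5}}) :
  5 %| #|G| -> P \in 'Syl_5(G) -> #|P| = 5.
Proof.
move=> dvG; rewrite inE => /card_Hall->.
have: #|G| %| 120 by rewrite -card_S5 cardSg ?subsetT.
rewrite dvdn_divisors //; move: #|_| dvG => n dvn.
by rewrite !inE p_part; repeat (case/orP => [/eqP n5|]); try move/eqP=> n5;
  move: dvn; rewrite n5.
Qed.

Definition Syl5 := 'Syl_5(S5).

Lemma mem_Syl (P : {group {perm 'I_5}}) : (P \in Syl5) = (#|P| == 5).
Proof.
apply/idP/eqP => [|oP]; last by rewrite inE card5_Sylow ?subsetT.
by apply: Sylow5_card; rewrite card_S5.
Qed.

Lemma Syl_A5 : 'Syl_5(A5) = Syl5.
Proof.
apply/setP=> P; rewrite mem_Syl; apply/idP/eqP => [|oP].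
  by apply: Sylow5_card; rewrite card_A5.
by rewrite inE card5_Sylow ?card5_sub_Alt.
Qed.

(** A unique Sylow 5-subgroup of A5 would be normal, against simplicity. *)
Lemma card_Syl6 : #|Syl5| = 6.
Proof.
have oA : #|A5| %| 120 by rewrite card_A5.
rewrite -Syl_A5; case: (card_Syl5_mod oA) => // n1.
have [P sylP] := Sylow_exists 5 A5.
have oP : #|P| = 5 by apply: (@Sylow5_card A5); rewrite ?card_A5 ?inE.
have nPA : A5 \subset 'N(P).
  move: (card_Syl sylP); rewrite n1 => /esym/eqP.
  by rewrite indexg_eq1 subsetI subxx.
have := A5_sub_normalised nPA; rewrite (setIidPl (card5_sub_Alt oP)).
rewrite -cardG_gt1 oP => /(_ isT)/subset_leq_card.
by rewrite card_A5 oP.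
Qed.

Lemma card_norm_Syl (P : {group {perm 'I_5}}) :
  P \in Syl5 -> #|'N(P)| = 20 /\ #|'N_A5(P)| = 10.
Proof.
move=> sylP; split; apply/eqP.
  have := sylP; rewrite inE => /card_Syl; rewrite -/Syl5 card_Syl6 setTI => idx.
  have := Lagrange (subsetT 'N(P)); rewrite card_S5 -idx.
  by rewrite -[120]/(20 * 6)%N => /eqP; rewrite eqn_pmul2r.
have := sylP; rewrite -Syl_A5 inE => /card_Syl; rewrite Syl_A5 card_Syl6 => idx.
have := Lagrange (subsetIl A5 'N(P)); rewrite card_A5 -idx.
by rewrite -[60]/(10 * 6)%N => /eqP; rewrite eqn_pmul2r.
Qed.

(** * Deciding statements about S5 by enumeration *)

(** Permutations do not compute; their lists of values do.  A property of
    permutations that can be read off from these lists is checked on all 120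
    of them. *)
Definition code (x : {perm 'I_5}) : seq nat := [seq val (x i) | i <- enum 'I_5].
Definition codes := permutations (iota 0 5).
Definition mulc (l m : seq nat) := [seq nth 0 m i | i <- l].
Definition odd_inversions (l : seq nat) :=
  odd (count (fun p => (p.1 < p.2) && (nth 0 l p.2 < nth 0 l p.1))
         [seq (i, j) | i <- iota 0 5, j <- iota 0 5]).

Lemma nth_code x (i : 'I_5) : nth 0 (code x) i = x i.
Proof. by rewrite (nth_map i) ?size_enum_ord // nth_ord_enum. Qed.

Lemma code_inj : injective code.
Proof.
by move=> x y exy; apply/permP=> i; apply: val_inj; rewrite /= -!nth_code exy.
Qed.

Lemma mem_code x : code x \in codes.
Proof.
rewrite mem_permutations; apply: uniq_perm; rewrite ?iota_uniq //.
  by rewrite map_inj_uniq ?enum_uniq //; apply: inj_comp val_inj perm_inj.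
move=> k; rewrite mem_iota /=; apply/mapP/idP => [[i _ ->] | lt_k5]; first exact: ltn_ord.
by exists (x^-1 (Ordinal lt_k5)); rewrite ?mem_enum // permKV.
Qed.

Lemma code1 : code 1 = iota 0 5.
Proof. by rewrite -val_enum_ord; apply: eq_map => i; rewrite perm1. Qed.

Lemma codeM x y : code (x * y) = mulc (code x) (code y).
Proof. by rewrite /mulc -map_comp; apply: eq_map => i; rewrite /= nth_code permM. Qed.

Definition tpermc a b : seq nat :=
  [seq (if k == a then b else if k == b then a else k) | k <- iota 0 5].

Lemma code_tperm (i j : 'I_5) : code (tperm i j) = tpermc i j.
Proof.
rewrite /tpermc -val_enum_ord -map_comp; apply: eq_map => k /=.
case: tpermP => [->|->|/eqP ki /eqP kj]; rewrite ?eqxx //.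
  by case: (eqVneq (j : nat) i).
by move: ki kj; rewrite -!val_eqE => /negPf-> /negPf->.
Qed.

Lemma all_codes (Q : pred (seq nat)) : all Q codes -> forall x, Q (code x).
Proof. by move=> /allP QP x; apply: QP; apply: mem_code. Qed.

Lemma all_ord5 (Q : pred nat) : all Q (iota 0 5) -> forall i : 'I_5, Q i.
Proof. by move=> /allP QP i; apply: QP; rewrite mem_iota /= ltn_ord. Qed.

(** Left multiplication by a transposition flips both parities (on lists this
    is checked on all of them), and every permutation is a product of
    transpositions. *)
Lemma odd_code x : odd_perm x = odd_inversions (code x).
Proof.
have step : forall (i j : 'I_5) y, i != j ->
    odd_inversions (mulc (tpermc i j) (code y)) = ~~ odd_inversions (code y).
  move=> i j y neq_ij; apply/eqP.
  pose Q l a b := (a != b) ==> (odd_inversions (mulc (tpermc a b) l) == ~~ odd_inversions l).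
  suff /(_ y) : forall y, all (fun a => all (Q (code y) a) (iota 0 5)) (iota 0 5).
    by move/all_ord5/(_ i)/all_ord5/(_ j)/implyP; apply.
  apply: (@all_codes (fun l => all (fun a => all (Q l a) (iota 0 5)) (iota 0 5))).
  by vm_compute.
have [ts -> {x}] := prod_tpermP x; elim: ts => [|[i j] ts IHts] /=.
  by rewrite big_nil odd_perm1 code1.
case/andP=> neq_ij /IHts {}IHts; rewrite big_cons odd_permM odd_tperm neq_ij.
by rewrite codeM code_tperm step //= IHts.
Qed.

(** The permutation with code [l] stabilises the set of [a] and [b]. *)
Definition codes_pair_fix (l : seq nat) a b :=
  ((nth 0 l a == a) && (nth 0 l b == b)) || ((nth 0 l a == b) && (nth 0 l b == a)).

Lemma fix_pair_code x (i j : 'I_5) :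
  (x \in 'N([set i; j] | 'P)) = codes_pair_fix (code x) i j.
Proof.
rewrite /codes_pair_fix !nth_code !val_eqE.
apply/idP/idP => [nx | fx].
  have fixO k : (x k \in [set i; j]) = (k \in [set i; j]).
    exact: (astabs_act k nx).
  have /esym := fixO i; have /esym := fixO j; rewrite !inE /= /aperm !eqxx orbT.
  have injx : x i = x j -> i = j by apply: perm_inj.
  case/esym/orP=> /eqP xj /esym/orP[]/eqP xi; rewrite xi xj ?eqxx ?orbT //.
    by rewrite -[j in _ == j]injx ?eqxx ?xi ?xj.
  by rewrite -[j in j == _]injx ?eqxx ?orbT ?xi ?xj.
rewrite !inE; apply/subsetP=> k; rewrite !inE /= /aperm.
by case/orP: fx => /andP[/eqP xi /eqP xj]; case/orP=> /eqP->;
  rewrite ?xi ?xj eqxx ?orbT.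
Qed.

(** The odd cycle types on five points are 2+1+1+1, 4+1 and 3+2. *)
Lemma odd_fixes_small x : odd_perm x ->
  exists2 O : {set 'I_5}, (#|O| == 1%N) || (#|O| == 2) & x \in 'N(O | 'P).
Proof.
rewrite odd_code.
pose Q l := has (fun a => nth 0 l a == a) (iota 0 5) ||
  has (fun a => has (fun b => (a != b) && codes_pair_fix l a b) (iota 0 5)) (iota 0 5).
have /(_ x)/implyP/[apply] : forall x, odd_inversions (code x) ==> Q (code x).
  by apply: (@all_codes (fun l => odd_inversions l ==> Q l)); vm_compute.
case/orP=> /hasP[a /[!mem_iota] lt_a].
  move=> xa; exists [set Ordinal lt_a]; first by rewrite cards1.
  have xi : x (Ordinal lt_a) = Ordinal lt_a.
    by apply: val_inj; rewrite /= -(nth_code x (Ordinal lt_a)) (eqP xa).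
  by rewrite !inE sub1set !inE /= /aperm xi.
case/hasP=> b /[!mem_iota] lt_b /andP[neq_ab fx].
exists [set Ordinal lt_a; Ordinal lt_b]; last by rewrite fix_pair_code.
by rewrite cards2 neq_ab.
Qed.

(** An odd permutation that stabilises a 2-subset is a transposition or has
    cycle type 3+2, so that its cube is a transposition. *)
Lemma odd_pair_cube x (O : {set 'I_5}) :
    odd_perm x -> #|O| = 2 -> x \in 'N(O | 'P) ->
  exists i j, [/\ i != j, (x ^+ 3) i = i & (x ^+ 3) j = j].
Proof.
move=> odd_x /eqP/cards2P[i [j [neq_ij ->]]]; rewrite fix_pair_code.
pose Q l a b := [&& a != b, odd_inversions l & codes_pair_fix l a b] ==>
  has (fun c => has (fun d => [&& c != d, nth 0 (mulc l (mulc l l)) c == c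
     & nth 0 (mulc l (mulc l l)) d == d]) (iota 0 5)) (iota 0 5).
have /(_ x)/all_ord5/(_ i)/all_ord5/(_ j) :
    forall x, all (fun a => all (Q (code x) a) (iota 0 5)) (iota 0 5).
  apply: (@all_codes (fun l => all (fun a => all (Q l a) (iota 0 5)) (iota 0 5))).
  by vm_compute.
move=> /implyP Qij fx; have [|c /[!mem_iota] lt_c] := hasP (Qij _).
  by rewrite neq_ij -odd_code odd_x.
case/hasP=> d /[!mem_iota] lt_d /and3P[neq_cd /eqP xc /eqP xd].
exists (Ordinal lt_c), (Ordinal lt_d); split=> //; apply: val_inj; rewrite /= -nth_code.
  by rewrite !expgS expg0 mulg1 !codeM.
by rewrite !expgS expg0 mulg1 !codeM.
Qed.

(** * Subgroups of S5 and normalisers of Sylow 5-subgroups *)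

(** An orbit or its complement has at most two elements. *)
Lemma intransitive_fixes_small (L : {group {perm 'I_5}}) :
  ~~ [transitive L, on setT | 'P] ->
  exists2 O : {set 'I_5}, (#|O| == 1%N) || (#|O| == 2) & L \subset 'N(O | 'P).
Proof.
move=> ntrL; pose O := orbit 'P L (ord0 : 'I_5).
have nOL : L \subset 'N(O | 'P).
  by apply: acts_orbit; rewrite ?subsetT.
have O0 : ord0 \in O by apply: orbit_refl.
have ltO : #|O| < 5.
  have := @proper_card _ (mem O) (mem setT); rewrite cardsT card_ord; apply.
  rewrite properT.
  apply: contraNneq ntrL => OT; apply/imsetP; exists ord0; rewrite ?inE //.
have gtO : 0 < #|O| by rewrite card_gt0; apply/set0Pn; exists ord0.
have [leO | gtO2] := leqP #|O| 2; first by exists O => //; case: #|O| gtO leO => [|[|[]]].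
exists (~: O); last first.
  apply/subsetP=> a /(subsetP nOL) na; rewrite inE.
  rewrite !inE; apply/subsetP=> i; rewrite !inE /= => nOi.
  by rewrite (astabs_act i na).
have := cardsC O; rewrite card_ord.
by case: #|O| ltO gtO2 => [|[|[|[|[|]]]]] // _ _; case: #|~: O| => [|[|[]]].
Qed.

(** A transitive subgroup has order divisible by 5.  Either its Sylow
    5-subgroup is normal, or it has all six Sylow 5-subgroups of S5; these
    generate a normal subgroup of S5, which contains A5 by simplicity. *)
Lemma subgroup_S5 (L : {group {perm 'I_5}}) :
  [\/ exists2 O : {set 'I_5}, (#|O| == 1%N) || (#|O| == 2) & L \subset 'N(O | 'P),
      exists2 P, P \in Syl5 & L \subset 'N(P)
    | A5 \subset L].
Proof.
have [trL | ntrL] := boolP [transitive L, on setT | 'P]; last first.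
  by apply: Or31; apply: intransitive_fixes_small.
have dv5 : 5 %| #|L| by have := atrans_dvd trL; rewrite cardsT card_ord.
have dv120 : #|L| %| 120 by rewrite -card_S5 cardSg ?subsetT.
have sSyl : 'Syl_5(L) \subset Syl5.
  by apply/subsetP=> P /(Sylow5_card dv5) oP; rewrite mem_Syl oP.
case: (card_Syl5_mod dv120) => nSyl.
  have [P sylP] := Sylow_exists 5 L; apply: Or32; exists P.
    by rewrite (subsetP sSyl) ?inE.
  move: (card_Syl sylP); rewrite nSyl => /esym/eqP.
  by rewrite indexg_eq1 subsetI subxx.
apply: Or33; have eqSyl : 'Syl_5(L) = Syl5.
  by apply/eqP; rewrite eqEcard sSyl card_Syl6 nSyl.
pose M := <<\bigcup_(P in Syl5) P>>%G.
have sML : M \subset L.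
  rewrite gen_subG; apply/bigcupsP=> P; rewrite -eqSyl inE.
  exact: pHall_sub.
apply: subset_trans sML; apply: A5_sub_normalised.
  apply: norms_gen; apply/subsetP=> a _; rewrite inE.
  rewrite -bigcupJ; apply/bigcupsP=> P; rewrite mem_Syl => /eqP oP.
  by apply: (bigcup_sup (P :^ a)%G); rewrite mem_Syl cardJg oP.
have [P] : exists P, P \in Syl5 by apply/set0Pn; rewrite -card_gt0 card_Syl6.
move=> sylP; have := sylP; rewrite mem_Syl => /eqP oP.
have /subset_leq_card : P \subset M :&: A5.
  by rewrite subsetI (card5_sub_Alt oP) andbT sub_gen ?(bigcup_sup P).
by rewrite oP -cardG_gt1; apply: leq_trans.
Qed.

(** Orbits of a group of order 5 have size 1 or 5. *)
Lemma card_Syl_orbit (X : finType) (to : {action {perm 'I_5} &-> X})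
    (P : {group {perm 'I_5}}) y :
  P \in Syl5 -> ~~ (P \subset 'C[y | to]) -> #|orbit to P y| = 5.
Proof.
rewrite mem_Syl card_orbit => /eqP oP npy.
have : #|P : 'C_P[y | to]| %| 5 by rewrite -[X in _ %| X]oP dvdn_indexg.
rewrite dvdn_divisors // !inE => /orP[|/eqP //].
by rewrite indexg_eq1 subsetI subxx (negPf npy).
Qed.

(** The normaliser in A5 has order 10, and the orbit of [y] under it has at
    least five elements because P alone moves [y] through five. *)
Lemma card_norm_Syl_astab (X : finType) (to : {action {perm 'I_5} &-> X})
    (P : {group {perm 'I_5}}) y :
  P \in Syl5 -> ~~ (P \subset 'C[y | to]) -> #|'N_A5(P) :&: 'C[y | to]| <= 2.
Proof.
move=> sylP npy; have oPy := card_Syl_orbit sylP npy.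
have [_ oN] := card_norm_Syl sylP.
have sPN : P \subset 'N_A5(P).
  by move: sylP; rewrite mem_Syl subsetI normG andbT => /eqP /card5_sub_Alt.
have leN : 5 <= #|orbit to 'N_A5(P) y|.
  have := subset_leq_card (imsetS (to y) sPN).
  by rewrite -/(orbit to P y) oPy.
have := card_orbit_stab to 'N_A5(P) y; rewrite oN.
move: #|_| #|orbit _ _ _| leN => m n le5n mn10.
by case: m mn10 => [|[|[|m]]] //; lia.
Qed.

Lemma Syl5_cycle (P : {group {perm 'I_5}}) x :
  P \in Syl5 -> x \in P -> x != 1 -> P :=: <[x]>.
Proof.
rewrite mem_Syl => /eqP oP Px ntx.
apply/eqP; rewrite eq_sym eqEcard cycle_subG Px /= oP.
have := order_dvdG Px; rewrite oP dvdn_divisors // !inE order_eq1.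
by rewrite (negPf ntx) /= -/#[x] => /eqP->.
Qed.

Lemma Syl_trans_points (P : {group {perm 'I_5}}) :
  P \in Syl5 -> [transitive P, on setT | 'P].
Proof.
move=> sylP; have oP := sylP; rewrite mem_Syl in oP.
have [i nPi] : exists i, ~~ (P \subset 'C[i | 'P]).
  apply/existsP; rewrite -negb_forall; apply: contraL oP => /forallP cP.
  suff -> : P :=: 1 by rewrite cards1.
  apply/trivgP/subsetP=> p Pp; rewrite inE; apply/eqP/permP=> i.
  by rewrite perm1; have /subsetP/(_ p Pp)/astab1P := cP i.
apply/imsetP; exists i; rewrite ?inE //; apply/esym/eqP.
by rewrite eqEcard subsetT cardsT card_ord card_Syl_orbit.
Qed.

Lemma Syl_moves_set (P : {group {perm 'I_5}}) (O : {set 'I_5}) :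
  P \in Syl5 -> 0 < #|O| < 5 -> ~~ (P \subset 'N(O | 'P)).
Proof.
move=> sylP /andP[]; rewrite card_gt0 => /set0Pn[i Oi]; apply: contraL => nOP.
suff -> : O = setT by rewrite cardsT card_ord.
apply/eqP; rewrite -subTset -(atransP (Syl_trans_points sylP) i) ?inE //.
by rewrite acts_sub_orbit.
Qed.

Lemma Syl_norm_Syl (P Q : {group {perm 'I_5}}) :
  P \in Syl5 -> Q \in Syl5 -> P \subset 'N(Q) -> P = Q.
Proof.
rewrite !mem_Syl => /eqP oP /eqP oQ nQP; apply/eqP.
rewrite -val_eqE eqEcard /= oP oQ leqnn andbT.
have sylQ : 5.-Sylow('N(Q)) Q by rewrite card5_Sylow ?normG.
by rewrite (sub_normal_Hall sylQ) ?normalG // /pgroup oP pnat_id.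
Qed.

(** The normaliser has order 20. *)
Lemma norm_Syl_order3 (P : {group {perm 'I_5}}) x :
  P \in Syl5 -> x \in 'N(P) -> x ^+ 3 = 1 -> x = 1.
Proof.
move=> sylP nPx x3; apply/eqP; rewrite -order_eq1.
have dv3 : #[x] %| 3 by rewrite order_dvdn x3.
have dv20 : #[x] %| 20.
  by have [<- _] := card_norm_Syl sylP; apply: order_dvdG.
by rewrite -dvdn1 -[1%N]/(gcdn 3 20) dvdn_gcd dv3.
Qed.

(** The normaliser of a Sylow 5-subgroup P is a Frobenius group.  The element
    p of P that takes [i] to [j] is unique, so [x] commutes with p; as p
    generates the transitive group P, fixing one point implies fixing all. *)
Lemma norm_Syl_semiregular (P : {group {perm 'I_5}}) x i j :
  P \in Syl5 -> x \in 'N(P) -> i != j -> x i = i -> x j = j -> x = 1.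
Proof.
move=> sylP nPx neq_ij xi xj.
have oP := sylP; rewrite mem_Syl in oP; have trP := Syl_trans_points sylP.
have abP : abelian P by apply/cyclic_abelian/prime_cyclic; rewrite (eqP oP).
have regP p k : p \in P -> p k = k -> p = 1.
  move=> Pp pk; apply/permP=> l; rewrite perm1.
  have [q Pq ->] := atransP2 trP (in_setT k) (in_setT l).
  by rewrite /= /aperm -permM -(centsP abP p Pp q Pq) permM pk.
have [p Pp /esym pij] := atransP2 trP (in_setT i) (in_setT j); rewrite /= /aperm in pij.
have xVi : x^-1 i = i by rewrite -{1}xi permK.
have cxp : p ^ x = p.
  apply/eqP; rewrite eq_mulgV1; apply/eqP/(@regP _ i).
    by rewrite groupM ?groupV ?memJ_norm.
  by rewrite !permM xVi pij xj -pij permK.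
have cPx l : x (p l) = p (x l) by rewrite -!permM -{2}cxp conjgE mulKVg.
have [p1 | ntp] := eqVneq p 1; first by rewrite -pij p1 perm1 eqxx in neq_ij.
have defP := Syl5_cycle sylP Pp ntp.
apply/permP=> l; rewrite perm1.
have [q] := atransP2 trP (in_setT i) (in_setT l); rewrite defP => /cycleP[m ->] ->.
rewrite /= /aperm; elim: m => [|m IHm]; first by rewrite expg0 perm1.
by rewrite expgSr permM cPx IHm.
Qed.

(** The cube would be an odd permutation with two fixed points. *)
Lemma odd_norm_Syl_pair (P : {group {perm 'I_5}}) x (O : {set 'I_5}) :
  P \in Syl5 -> x \in 'N(P) -> odd_perm x -> #|O| = 2 -> x \notin 'N(O | 'P).
Proof.
move=> sylP nPx odd_x oO; apply/negP=> nOx.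
have [i [j [neq_ij xi xj]]] := odd_pair_cube odd_x oO nOx.
have x3 := norm_Syl_semiregular sylP (groupX 3 nPx) neq_ij xi xj.
move: (congr1 (fun y : {perm _} => odd_perm y) x3).
by rewrite !expgS expg0 !odd_permM odd_perm1 odd_x.
Qed.

Lemma order5_norm (P Q : {group {perm 'I_5}}) x :
  P \in Syl5 -> Q \in Syl5 -> x \in P -> x != 1 -> x \in 'N(Q) -> P = Q.
Proof.
move=> sylP sylQ Px ntx nQx; apply: Syl_norm_Syl => //.
by rewrite (Syl5_cycle sylP Px ntx) cycle_subG.
Qed.

Lemma order5_set (P : {group {perm 'I_5}}) (O : {set 'I_5}) x :
  P \in Syl5 -> x \in P -> x != 1 -> 0 < #|O| < 5 -> x \notin 'N(O | 'P).
Proof.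
move=> sylP Px ntx oO; apply: contra (Syl_moves_set sylP oO) => nOx.
by rewrite (Syl5_cycle sylP Px ntx) cycle_subG.
Qed.

Definition transporter (X : finType) (to : {action {perm 'I_5} &-> X}) b (x y : X) :=
  [set a | (odd_perm a == b) && (to x a == y)].

Lemma transporterP (X : finType) (to : {action {perm 'I_5} &-> X}) b x y a :
  reflect (odd_perm a = b /\ to x a = y) (a \in transporter to b x y).
Proof. by rewrite inE; apply: (iffP andP) => -[/eqP ? /eqP ?]. Qed.

(** The normaliser has order 20 in S5 and 10 in A5, so it has an odd element:
    Sylow conjugacy can be realised in either parity, and the transporter
    contains a coset of the normaliser in A5. *)
Lemma card_transporter_Syl (P Q : {group {perm 'I_5}}) b :
  P \in Syl5 -> Q \in Syl5 -> 10 <= #|transporter 'JG b P Q|.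
Proof.
move=> sylP sylQ; have [oN oNA] := card_norm_Syl sylP.
have [c nPc odd_c] : exists2 c, c \in 'N(P) & odd_perm c.
  apply/exists_inP/contraT; rewrite negb_exists_in => /forall_inP evN.
  have : 'N(P) \subset 'N_A5(P).
    by rewrite subsetI subxx andbT; apply/subsetP=> c /evN; rewrite Alt_even.
  by move/subset_leq_card; rewrite oN oNA.
have [d defQ] : exists d, Q = (P :^ d)%G.
  rewrite !inE in sylP sylQ; have [d _ defQ] := Sylow_trans sylP sylQ.
  by exists d; apply/val_inj.
have [a odd_a defQa] : exists2 a, odd_perm a = b & Q = (P :^ a)%G.
  have [odd_d | odd_d] := eqVneq (odd_perm d) b; first by exists d.
  exists (c * d); first by rewrite odd_permM odd_c; case: odd_perm b odd_d => [] [].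
  by apply/val_inj; rewrite /= conjsgM (normP nPc) defQ.
rewrite -oNA -(card_rcoset _ a) subset_leq_card //.
apply/subsetP=> _ /rcosetP[n /setIP[An nPn] ->]; rewrite inE.
rewrite Alt_even in An; rewrite odd_permM (negPf An) odd_a eqxx /=.
by rewrite -val_eqE /= conjsgM (normP nPn) defQa.
Qed.

(** Such a set lies in one right coset. *)
Lemma leq_card_divl (gT : finGroupType) (D : {set gT}) (M : {group gT}) :
  {in D &, forall a b, a * b^-1 \in M} -> #|D| <= #|M|.
Proof.
move=> DM; have [-> | [d Dd]] := set_0Vmem D; first by rewrite cards0.
rewrite -(card_rcoset M d) subset_leq_card //.
by apply/subsetP=> a Da; rewrite mem_rcoset DM.
Qed.

Lemma card_transporterI (X : finType) (to : {action {perm 'I_5} &-> X})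
    (P Q : {group {perm 'I_5}}) b x y :
  P \in Syl5 -> ~~ (P \subset 'C[x | to]) ->
  #|transporter 'JG b P Q :&: transporter to b x y| <= 2.
Proof.
move=> sylP nxP; apply: leq_trans (card_norm_Syl_astab sylP nxP).
apply: (@leq_card_divl _ _ ('N_A5(P) :&: 'C[x | to])%G) => a c.
move=> /setIP[/transporterP[oa Pa] /transporterP[_ xa]].
move=> /setIP[/transporterP[oc Pc] /transporterP[_ xc]].
apply/setIP; split; last by apply/astab1P; rewrite actM xa -xc actK.
apply/setIP; split; first by rewrite Alt_even odd_permM odd_permV oa oc addbb.
have /astab1P : ('JG)%act P (a * c^-1) = P by rewrite actM Pa -Pc actK.
by rewrite astab1JG.
Qed.

(** * Coordinates in the wreath product *)

Local Notation W := S5_wr_S3.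
Definition top (u : W) : {perm 'I_3} := u.1.
Definition coord (u : W) (i : 'I_3) : {perm 'I_5} := u.2 i.

Definition wreath_elt (p : {perm 'I_3}) (f : 'I_3 -> {perm 'I_5}) : W :=
  SdPair permute_coords_groupAction (ax := (p, [ffun i => f i]))
    (introT setXP (conj (in_setT _) (in_setT _))).

Lemma topM u v : top (u * v) = top u * top v. Proof. by []. Qed.
(** The top factor is written on the left, so that the coordinates of [u] are
    permuted by the top component of [v] before they are multiplied. *)
Lemma coordM u v i : coord (u * v) i = coord u ((top v)^-1 i) * coord v i.
Proof. by rewrite /coord /= !ffunE. Qed.
Lemma top1 : top 1 = 1. Proof. by []. Qed.
Lemma coord1 i : coord 1 i = 1. Proof. by rewrite /coord /= ffunE. Qed.
Lemma top_wreath_elt p f : top (wreath_elt p f) = p. Proof. by []. Qed.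
Lemma coord_wreath_elt p f i : coord (wreath_elt p f) i = f i.
Proof. by rewrite /coord /= ffunE. Qed.
Lemma wreath_eq u v : top u = top v -> coord u =1 coord v -> u = v.
Proof.
case: u v => [[p f] pf] [[q g] qg]; rewrite /top /coord /= => epq efg.
by apply: val_inj; rewrite /= epq; congr (_, _); apply/ffunP.
Qed.
Lemma topV u : top u^-1 = (top u)^-1. Proof. by []. Qed.
Lemma coordV u i : coord u^-1 i = (coord u (top u i))^-1.
Proof.
apply/eqP; rewrite eq_sym eq_invg_mul.
by have := coordM u u^-1 i; rewrite mulgV coord1 topV invgK => <-.
Qed.

Local Notation G := A5cube6.

Definition o0 : 'I_3 := @Ordinal 3 0 isT.
Definition o1 : 'I_3 := @Ordinal 3 1 isT.
Definition o2 : 'I_3 := @Ordinal 3 2 isT.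

Lemma ord3P (Q : 'I_3 -> Prop) : Q o0 -> Q o1 -> Q o2 -> forall i, Q i.
Proof.
move=> Q0 Q1 Q2 [[|[|[|//]]] lt_i3].
- by rewrite (_ : Ordinal _ = o0) //; apply: val_inj.
- by rewrite (_ : Ordinal _ = o1) //; apply: val_inj.
- by rewrite (_ : Ordinal _ = o2) //; apply: val_inj.
Qed.

Definition rot3 : {perm 'I_3} := perm (@ordS_inj 3).

Lemma rot3E : (rot3 o0 = o1) * (rot3 o1 = o2) * (rot3 o2 = o0).
Proof. by do !split; rewrite permE; apply: val_inj. Qed.

Lemma rot3VE : (rot3^-1 o0 = o2) * (rot3^-1 o1 = o0) * (rot3^-1 o2 = o1).
Proof. by do !split; apply: (@perm_inj _ rot3); rewrite permKV !rot3E. Qed.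

Lemma rot3_cube : rot3 * rot3 * rot3 = 1.
Proof. by apply/permP; apply: ord3P; rewrite !permM !rot3E perm1. Qed.

Lemma rot3_neq1 : rot3 != 1.
Proof. by apply/eqP=> s1; have := rot3E.1.1; rewrite s1 perm1. Qed.

Lemma order_rot3 : #[rot3] = 3.
Proof.
apply: nt_prime_order rot3_neq1 => //.
by rewrite !expgS expg0 mulg1 mulgA rot3_cube.
Qed.

Lemma Alt3P p : reflect [\/ p = 1, p = rot3 | p = rot3^-1] (p \in 'Alt_('I_3)).
Proof.
have sA : rot3 \in 'Alt_('I_3).
  rewrite Alt_even; move: (congr1 (fun y : {perm _} => odd_perm y) rot3_cube).
  by rewrite !odd_permM odd_perm1; case: (odd_perm rot3).
have <- : <[rot3]> = 'Alt_('I_3).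
  apply/eqP; rewrite eqEcard cycle_subG sA -/#[rot3] order_rot3 /=.
  have := @card_Alt 'I_3; rewrite card_ord => /(_ isT)/eqP.
  by rewrite -[3`!]/(2 * 3)%N eqn_pmul2l // => /eqP ->.
apply: (iffP idP) => [/cyclePmin[m]|].
  rewrite order_rot3; case: m => [|[|[|//]]] _ ->; rewrite ?expg0 ?expg1.
  - by apply: Or31.
  - by apply: Or32.
  apply: Or33; apply/eqP; rewrite eq_sym eq_invg_mul !expgS expg0 mulg1 mulgA.
  by rewrite rot3_cube.
by case=> ->; rewrite ?group1 ?groupV ?cycle_id.
Qed.

(** On A5cube6 all coordinates have the parity of coordinate 0. *)
Definition parity (u : W) := odd_perm (coord u o0).

Lemma mem_A5cube6P u :
  reflect (top u \in 'Alt_('I_3) /\ forall i, odd_perm (coord u i) = parity u)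
          (u \in G).
Proof.
have -> : (u \in G) = (top u \in 'Alt_('I_3))
    && [forall i, forall j, odd_perm (coord u i) == odd_perm (coord u j)] := in_set _ _.
apply: (iffP andP) => [[-> /'forall_forallP e] | [-> e]]; split=> //.
  by move=> i; apply/eqP/e.
by apply/'forall_forallP=> i j; rewrite (e i) (e j).
Qed.

(** * The action on triples *)

Section TripleAction.
Context (X : finType) (to : {action {perm 'I_5} &-> X}).

(** The product action of the wreath product on triples over an S5-set. *)
Definition triple_fun (t : {ffun 'I_3 -> X}) (u : W) : {ffun 'I_3 -> X} :=
  [ffun i => to (t ((top u)^-1 i)) (coord u i)].

Lemma triple_fun_is_action : is_action [set: W] triple_fun.
Proof.
split=> [u t t' /ffunP e | t u v _ _].
  apply/ffunP=> i; have := e (top u i); rewrite !ffunE permK.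
  exact: (act_inj to).
by apply/ffunP=> i; rewrite !ffunE topM coordM invMg permM actM.
Qed.
Canonical triple_act := Action triple_fun_is_action.

Lemma triple_fixP (t : {ffun 'I_3 -> X}) u :
  reflect (forall i, to (t i) (coord u (top u i)) = t (top u i))
          (u \in 'C[t | triple_act]).
Proof.
apply: (iffP astab1P) => [/ffunP e i | e].
  by have := e (top u i); rewrite ffunE permK.
by apply/ffunP=> i; rewrite ffunE -{2 3}[i](permKV (top u)) e.
Qed.

(** The return of a rotating element is the product of its coordinates along
    the cycle that starts and ends at 0. *)
Lemma coord_cube (g : W) : top g = rot3 ->
  coord (g ^+ 3) o0 = coord g o1 * coord g o2 * coord g o0.
Proof.
by move=> gs; rewrite !expgSr expg0 mul1g !coordM gs !rot3VE.
Qed.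

Lemma top_cube (g : W) : top g = rot3 -> top (g ^+ 3) = 1.
Proof. by move=> gs; rewrite !expgSr expg0 mul1g !topM gs rot3_cube. Qed.

(** A rotating element transports each entry of a fixed triple to the next
    one; after one turn, the entry at 0 is fixed by the return. *)
Lemma triple_fix_rot (t : {ffun 'I_3 -> X}) (g : W) :
    top g = rot3 -> g \in 'C[t | triple_act] ->
  [/\ t o1 = to (t o0) (coord g o1), t o2 = to (t o1) (coord g o2),
      t o0 = to (t o2) (coord g o0) & to (t o0) (coord (g ^+ 3) o0) = t o0].
Proof.
move=> gs /triple_fixP e.
have := e o0; have := e o1; have := e o2; rewrite gs !rot3E => e2 e1 e0.
by rewrite coord_cube // !actM e0 e1 e2.
Qed.

(** The converse of [triple_fix_rot], for a whole subgroup: a point fixed by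
    the coordinates at 0 of the base part of H is transported by [g] to a
    triple.  Conjugation by [g] shows that the base part of H fixes the other
    two entries as well, and H is generated by its base part and [g]. *)
Lemma triple_fix (H : {group W}) (g : W) y :
    H \subset G -> g \in H -> top g = rot3 ->
    {in H, forall k, top k = 1 -> to y (coord k o0) = y} ->
  exists t : {ffun 'I_3 -> X}, [/\ t o0 = y, forall i, exists a, t i = to y a
     & H \subset 'C[t | triple_act]].
Proof.
move=> sHG Hg gs fixy.
pose t : {ffun 'I_3 -> X} := [ffun i => if i == o0 then y
  else if i == o1 then to y (coord g o1) else to (to y (coord g o1)) (coord g o2)].
have fix_g : g \in 'C[t | triple_act].
  apply/triple_fixP; rewrite gs; apply: ord3P; rewrite rot3E !ffunE //=.
  by rewrite -!actM ?mulgA -coord_cube // fixy ?groupX ?top_cube.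
have step i : {in H, forall k, top k = 1 -> to (t i) (coord k i) = t i} ->
              {in H, forall k, top k = 1 -> to (t (rot3 i)) (coord k (rot3 i)) = t (rot3 i)}.
  move=> fix_i k Hk k1; have /triple_fixP/(_ i) := fix_g; rewrite gs => tsi.
  have := fix_i (g * k * g^-1); rewrite !groupM ?groupV // !topM topV gs k1.
  rewrite mulg1 mulgV => /(_ isT erefl); rewrite !coordM coordV topV gs invgK k1 invg1.
  by rewrite perm1 !actM tsi => e; rewrite -[RHS]tsi -[in RHS]e actKV.
have fix0 : {in H, forall k, top k = 1 -> to (t o0) (coord k o0) = t o0}.
  by move=> k Hk k1; rewrite ffunE /= fixy.
have fix1 := step _ fix0; have fix2 := step _ fix1; rewrite !rot3E in fix1 fix2.
have fix_k k : k \in H -> top k = 1 -> k \in 'C[t | triple_act].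
  move=> Hk k1; apply/triple_fixP; rewrite k1.
  by apply: ord3P; rewrite perm1; auto.
exists t; split; first by rewrite ffunE.
  by apply: ord3P; rewrite ffunE /=; [exists 1; rewrite act1 | eexists | rewrite -actM; eexists].
apply/subsetP=> h Hh; have /mem_A5cube6P[/Alt3P[] h1 _] := subsetP sHG h Hh.
- exact: fix_k.
- rewrite -[h](mulgKV g) groupM // fix_k ?groupM ?groupV //.
  by rewrite topM topV gs h1 mulgV.
- rewrite -[h](mulgK g) groupM ?groupV // fix_k ?groupM ?groupV //.
  by rewrite topM gs h1 mulVg.
Qed.

End TripleAction.

(** * Goursat's lemma for subgroups of the socle *)

Definition base_set : {set W} := [set u | top u == 1].
Lemma base_group_set : group_set base_set.
Proof.
apply/group_setP; split=> [|u v]; rewrite !inE ?top1 //.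
by rewrite topM => /eqP-> /eqP->; rewrite mulg1.
Qed.
Canonical base := Group base_group_set.
Lemma baseP u : reflect (top u = 1) (u \in base).
Proof. by rewrite inE; apply: eqP. Qed.

Definition socle_set : {set W} :=
  [set u | (top u == 1) && [forall i, ~~ odd_perm (coord u i)]].
Lemma socle_group_set : group_set socle_set.
Proof.
apply/group_setP; split=> [|u v]; rewrite !inE ?top1 ?eqxx.
  by apply/forallP=> i; rewrite coord1 odd_perm1.
case/andP=> /eqP u1 /forallP eu /andP[/eqP v1 /forallP ev].
rewrite topM u1 v1 mulg1 eqxx /=; apply/forallP=> i.
by rewrite coordM odd_permM (negPf (eu _)) (negPf (ev _)).
Qed.
Canonical socle := Group socle_group_set.
Lemma socleP u :
  reflect (top u = 1 /\ forall i, odd_perm (coord u i) = false) (u \in socle).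
Proof.
rewrite inE; apply: (iffP andP) => [[/eqP-> /forallP e] | [-> e]]; split=> //.
  by move=> i; exact: negbTE (e i).
by apply/forallP=> i; rewrite e.
Qed.

Lemma socle_base : socle \subset base.
Proof. by apply/subsetP=> u /socleP[u1 _]; apply/baseP. Qed.

Lemma coord_homM i : {in base &, {morph coord^~ i : u v / u * v}}.
Proof. by move=> u v _ /baseP v1 /=; rewrite coordM v1 invg1 perm1. Qed.
Canonical coord_hom i := Morphism (coord_homM i).

Lemma coord_homE i u : coord_hom i u = coord u i. Proof. by []. Qed.

Lemma topJ u v : top u = 1 -> top (u ^ v) = 1.
Proof. by move=> u1; rewrite conjgE !topM topV u1 mul1g mulVg. Qed.

Lemma coordJ u v i : top u = 1 -> coord (u ^ v) (top v i) = coord u i ^ coord v (top v i).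
Proof.
by move=> u1; rewrite !conjgE !coordM topM u1 mul1g coordV !permK.
Qed.

Lemma socle_norm v : v \in 'N(socle).
Proof.
rewrite inE; apply/subsetP=> _ /imsetP[u /socleP[u1 eu] ->].
apply/socleP; split; first exact: topJ.
by move=> i; rewrite -[i](permKV (top v)) coordJ // odd_permJ eu.
Qed.

Lemma coord_socle i u : u \in socle -> coord u i \in A5.
Proof. by case/socleP=> _ e; rewrite Alt_even e. Qed.

(** [rot3] is transitive on the three indices. *)
Lemma rot3_propagate (Q : 'I_3 -> Prop) :
  (forall i, Q i -> Q (rot3 i)) -> (exists i, Q i) -> forall i, Q i.
Proof.
move=> step [i Qi]; have Qs := step _ Qi; have Qss := step _ Qs.
by move: i Qi Qs Qss; apply: ord3P; rewrite !rot3E => ? ? ?; apply: ord3P.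
Qed.

(** Each coordinate alone is faithful on K. *)
Definition separating (K : {set W}) :=
  [forall k in K, forall i, (coord k i == 1) ==> (k == 1)].

(** Say that [i] determines [j] if coordinate [j] is trivial on the elements
    of K whose coordinate [i] is trivial.  This is a preorder on the indices,
    invariant under rotation, so that a single non-trivial instance makes all
    indices equivalent, which is to say that K is separating.  Otherwise the
    kernels in K of coordinates 1 and 2 have non-trivial images under
    coordinate 0, normal in A5 and thus equal to A5.  Their commutator is
    trivial at coordinates 1 and 2 and still maps onto A5, because A5 is
    perfect: K contains the first factor of the socle, and by rotation the
    other two. *)
Lemma socle_sub_or_separating (K : {group W}) (g : W) :
    K \subset socle -> g \in 'N(K) -> top g = rot3 ->
    (forall a, a \in A5 -> exists2 k, k \in K & coord k o0 = a) ->
  socle \subset K \/ separating K.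
Proof.
move=> sKN nKg gs onto0; have [sepK | nsepK] := boolP (separating K); first by right.
have K1 k : k \in K -> top k = 1 by move/(subsetP sKN)/socleP=> [].
have coJg k i : k \in K -> coord (k ^ g) (rot3 i) = coord k i ^ coord g (rot3 i).
  by move=> Kk; have := coordJ g i (K1 k Kk); rewrite gs.
have KJ k : k \in K -> k ^ g \in K by rewrite memJ_norm.
have AJ c a : a \in A5 -> a ^ c \in A5 by rewrite !Alt_even odd_permJ.
have onto i : forall a, a \in A5 -> exists2 k, k \in K & coord k i = a.
  move: i; apply: rot3_propagate; last by exists o0.
  move=> i ontoi a Aa; have [k Kk ka] := ontoi (a ^ (coord g (rot3 i))^-1) (AJ _ _ Aa).
  by exists (k ^ g); rewrite ?KJ // coJg // ka conjgKV.
have sKB : K \subset base := subset_trans sKN socle_base.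
have imK i : coord_hom i @* K = A5.
  apply/eqP; rewrite eqEsubset; apply/andP; split.
    by apply/subsetP=> _ /morphimP[k _ Kk ->]; rewrite coord_socle ?(subsetP sKN).
  apply/subsetP=> a /(onto i)[k Kk <-].
  by apply/morphimP; exists k; rewrite ?(subsetP sKB).
pose det i j := [forall k in K, (coord k i == 1) ==> (coord k j == 1)].
have detP i j : det i j -> forall k, k \in K -> coord k i = 1 -> coord k j = 1.
  by move=> /forall_inP e k /e/implyP ekij /eqP/ekij/eqP.
have detI i j : (forall k, k \in K -> coord k i = 1 -> coord k j = 1) -> det i j.
  by move=> e; apply/forall_inP=> k Kk; apply/implyP=> /eqP/(e k Kk)/eqP.
(* Conjugation by [g] shifts the indices by one. *)
have det_rot i j : det i j -> det (rot3 i) (rot3 j).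
  move/detP=> e; apply: detI => k Kk; rewrite -[k](conjgKV g).
  have Kk' : k ^ g^-1 \in K by rewrite memJ_norm ?groupV.
  by rewrite !coJg // => /eqP; rewrite conjg_eq1 => /eqP/(e _ Kk')->; rewrite conj1g.
have det_trans i j k : det i j -> det j k -> det i k.
  by move=> /detP eij /detP ejk; apply: detI => u Ku /(eij u Ku)/(ejk u Ku).
have not_det : ~ (forall i j, det i j).
  move=> detK; case/negP: nsepK; apply/forall_inP=> k Kk; apply/forallP=> i.
  apply/implyP=> /eqP ki; apply/eqP/wreath_eq; first by rewrite K1.
  by move=> j; rewrite coord1 (detP _ _ (detK i j)).
have det_refl i : det i i by apply: detI.
have ndet10 : ~~ det o1 o0.
  apply/negP=> d10; have := det_rot _ _ d10; rewrite !rot3E => d21.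
  have := det_rot _ _ d21; rewrite !rot3E => d02; apply: not_det.
  have d20 := det_trans _ _ _ d21 d10; have d01 := det_trans _ _ _ d02 d21.
  have d12 := det_trans _ _ _ d10 d02.
  by apply: ord3P; apply: ord3P; rewrite ?det_refl ?d10 ?d21 ?d02 ?d20 ?d01 ?d12.
have ndet20 : ~~ det o2 o0.
  apply/negP=> d20; have := det_rot _ _ d20; rewrite !rot3E => d01.
  have := det_rot _ _ d01; rewrite !rot3E => d12; apply: not_det.
  have d10 := det_trans _ _ _ d12 d20; have d21 := det_trans _ _ _ d20 d01.
  have d02 := det_trans _ _ _ d01 d12.
  by apply: ord3P; apply: ord3P; rewrite ?det_refl ?d10 ?d21 ?d02 ?d20 ?d01 ?d12.
have nK i : 'ker_K (coord_hom i) <| K.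
  by rewrite /normal subsetIl normsI ?normG // (subset_trans sKB) ?ker_norm.
(* The image is normal in A5 and not trivial, hence all of A5. *)
have im_ker i : ~~ det i o0 -> coord_hom o0 @* 'ker_K (coord_hom i) = A5.
  move=> ndet; apply/eqP; rewrite eqEsubset -{1}(imK o0) morphimS ?subsetIl //=.
  have /normal_norm := morphim_normal (coord_hom o0) (nK i); rewrite imK => nA.
  apply: A5_sub_normalised => //; rewrite (setIidPl _); last first.
    by rewrite -(imK o0) morphimS ?subsetIl.
  apply: contra ndet => /eqP im1; apply: detI => k Kk ki.
  apply/set1gP; rewrite -im1 -coord_homE mem_morphim ?(subsetP sKB) //.
  by apply/setIP; split=> //; apply/kerP; rewrite ?(subsetP sKB).
left.
have first_factor a : a \in A5 ->
    exists2 k, k \in K & coord k o0 = a /\ forall j, j != o0 -> coord k j = 1.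
  move=> Aa; pose L := [~: 'ker_K (coord_hom o1), 'ker_K (coord_hom o2)].
  have sLK : L \subset 'ker_K (coord_hom o1) :&: 'ker_K (coord_hom o2).
    rewrite commg_subI // subsetI subxx /=.
      exact: subset_trans (subsetIl _ _) (normal_norm (nK o2)).
    exact: subset_trans (subsetIl _ _) (normal_norm (nK o1)).
  have imL : coord_hom o0 @* L = A5.
    by rewrite morphimR ?(subset_trans (subsetIl _ _)) // !im_ker // -derg1 der_A5.
  move: Aa; rewrite -imL => /morphimP[k Bk Lk ->].
  have /setIP[/setIP[Kk /mker k1] /setIP[_ /mker k2]] := subsetP sLK k Lk.
  by exists k => //; split=> //; apply: ord3P.
have factor i a : a \in A5 ->
    exists2 k, k \in K & coord k i = a /\ forall j, j != i -> coord k j = 1.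
  move: i a; apply: rot3_propagate; last by exists o0.
  move=> i IHi a Aa; have [k Kk [ki kj]] := IHi (a ^ (coord g (rot3 i))^-1) (AJ _ _ Aa).
  exists (k ^ g); first exact: KJ.
  split=> [|j]; first by rewrite coJg // ki conjgKV.
  rewrite -{1 2}[j](permKV rot3) (inj_eq perm_inj) => neq_ji.
  by rewrite coJg // kj // conj1g.
apply/subsetP=> n nN; have [n1 _] := socleP _ nN.
have [k0 Kk0 [k00 k0j]] := factor o0 _ (coord_socle o0 nN).
have [k1 Kk1 [k11 k1j]] := factor o1 _ (coord_socle o1 nN).
have [k2 Kk2 [k22 k2j]] := factor o2 _ (coord_socle o2 nN).
have -> : n = k0 * k1 * k2; last by rewrite !groupM.
apply: wreath_eq; first by rewrite !topM n1 !K1 // !mulg1.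
move=> i; rewrite !coordM !K1 // !invg1 !perm1; move: i.
by apply: ord3P; rewrite ?k00 ?k11 ?k22 ?k0j ?k1j ?k2j // ?mulg1 ?mul1g.
Qed.

(** * Proper subgroups that contain a generator of G modulo the socle *)

Local Notation subset_act := ('P^* : {action {perm 'I_5} &-> {set 'I_5}})%act.
Local Notation syl_act := ('JG : {action {perm 'I_5} &-> {group {perm 'I_5}}})%act.
Local Notation fixes H t to := (H \subset 'C[t | triple_act to]).

Definition subset_type n (H : {set W}) :=
  exists2 t : {ffun 'I_3 -> {set 'I_5}}, forall i, #|t i| = n & fixes H t subset_act.
Definition syl_type (H : {set W}) :=
  exists2 t : {ffun 'I_3 -> {group {perm 'I_5}}}, forall i, t i \in Syl5
    & fixes H t syl_act.
(** The second condition makes coordinate 0 map the trace of H on the socle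
    onto A5. *)
Definition diag_type (H : {set W}) :=
  separating (H :&: base) /\
  (forall a, a \in A5 -> exists2 k, k \in H :&: socle & coord k o0 = a).

(** Modulo the socle, G is generated by [g]: a power of [g] adjusts the top
    component, and [g ^+ 3] the parity. *)
Lemma socle_rotation_generate (H : {group W}) g :
  H \subset G -> g \in H -> top g = rot3 -> parity g -> socle \subset H -> G \subset H.
Proof.
move=> sHG Hg gs odd_g sNH.
have Gg := subsetP sHG g Hg; have g3 := top_cube gs.
have step0 u : u \in G -> top u = 1 -> u \in H.
  move=> Gu u1; have [odd_u | even_u] := boolP (parity u).
    rewrite -(mulgK (g ^+ 3) u) groupM ?groupV ?groupX // (subsetP sNH) //.
    have /mem_A5cube6P[_ e] : u * g ^+ 3 \in G by rewrite groupM ?groupX.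
    apply/socleP; split=> [|i]; first by rewrite topM u1 g3 mulg1.
    rewrite e /parity coordM g3 invg1 perm1 odd_permM -/(parity u) odd_u.
    by have /mem_A5cube6P[_ e'] := Gg; rewrite coord_cube // !odd_permM !e' odd_g.
  rewrite (subsetP sNH) //; apply/socleP; split=> // i.
  by have /mem_A5cube6P[_ ->] := Gu; apply/negbTE.
apply/subsetP=> u Gu; have /mem_A5cube6P[/Alt3P[] us _] := Gu.
- exact: step0.
- rewrite -(mulgKV g u) groupM // step0 ?groupM ?groupV //.
  by rewrite topM topV gs us mulgV.
- rewrite -(mulgK g u) groupM ?groupV // step0 ?groupM //.
  by rewrite topM gs us mulVg.
Qed.

(** Apply [subgroup_S5] to the group of the coordinates at 0 of the base part
    of H.  If that group fixes something, [triple_fix] applies.  If it contains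
    A5, then so does the image of the trace of H on the socle, because A5 is
    perfect and commutators of base elements lie in the socle; then Goursat's
    lemma leaves only the diagonal case, H being proper. *)
Lemma trichotomy (H : {group W}) g :
    H \proper G -> g \in H -> top g = rot3 -> parity g ->
  [\/ subset_type 1 H, subset_type 2 H, syl_type H | diag_type H].
Proof.
move=> prH Hg gs odd_g; have sHG := proper_sub prH.
pose L := (coord_hom o0 @* (H :&: base))%G.
have memL k : k \in H -> top k = 1 -> coord k o0 \in L.
  move=> Hk /baseP Bk; apply/morphimP; exists k => //.
  by rewrite inE Hk.
case: (subgroup_S5 L) => [[O oO nOL]|[P sylP nPL]|sAL].
- have fixO : {in H, forall k, top k = 1 -> subset_act O (coord k o0) = O}.
    move=> k Hk k1; apply/astab1P; rewrite astab1_set.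
    exact: (subsetP nOL _ (memL k Hk k1)).
  have [t [_ tO fixt]] := triple_fix sHG Hg gs fixO.
  have ot i : #|t i| = #|O|.
    by have [a ->] := tO i; rewrite /= setactE card_imset //; apply: act_inj.
  case/orP: oO => /eqP oO; [apply: Or41 | apply: Or42]; exists t => // i;
    by rewrite ot.
- have fixP : {in H, forall k, top k = 1 -> syl_act P (coord k o0) = P}.
    move=> k Hk k1; apply/astab1P; rewrite astab1JG.
    exact: (subsetP nPL _ (memL k Hk k1)).
  have [t [_ tP fixt]] := triple_fix sHG Hg gs fixP.
  apply: Or43; exists t => // i; have [a ->] := tP i.
  by rewrite mem_Syl /= cardJg -mem_Syl.
pose K := (H :&: socle)%G.
have sKN : K \subset socle by apply: subsetIr.
have nKg : g \in 'N(K).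
  by apply: (subsetP (normsI (normG H) _)) => //; apply/subsetP=> h _; apply: socle_norm.
have onto0 a : a \in A5 -> exists2 k, k \in K & coord k o0 = a.
  rewrite -der_A5 => Da; have : a \in L^`(1) by apply: (subsetP (dergS 1 sAL)).
  rewrite derg1 -morphimR ?subsetIr // => /morphimP[k Bk Dk ->].
  exists k => //; apply: (subsetP _ k Dk); rewrite gen_subG.
  apply/subsetP=> _ /imset2P[u v /setIP[Hu Bu] /setIP[Hv Bv] ->].
  rewrite inE groupR //=; have := groupR Bu Bv => /baseP uv1.
  apply/socleP; split=> // i; rewrite -coord_homE morphR // !odd_permM !odd_permV.
  by do 2!case: odd_perm.
have [sNH | sepK] := socle_sub_or_separating sKN nKg gs onto0.
  case/andP: prH => _ /negP[]; apply: socle_rotation_generate Hg gs odd_g _ => //.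
  by apply: subset_trans sNH _; apply: subsetIl.
apply: Or44; split=> //; apply/forall_inP=> k /setIP[Hk /baseP k1].
apply/forallP=> i; apply/implyP=> /eqP ki; apply: (implyP (forallP (forall_inP sepK k _) i)).
  rewrite inE Hk; apply/socleP; split=> // j.
  have /mem_A5cube6P[_ e] := subsetP sHG k Hk.
  by rewrite e -(e i) ki odd_perm1.
by rewrite ki.
Qed.

(** * Diagonal subgroups *)

Lemma coordX u n i : u \in base -> coord (u ^+ n) i = coord u i ^+ n.
Proof. by move=> Bu; rewrite -!coord_homE morphX. Qed.

(** All coordinates of a base element of a diagonal subgroup have the same
    order. *)
Lemma diag_expg (H : {group W}) u i j n :
  diag_type H -> u \in H -> u \in base -> coord u i ^+ n = 1 -> coord u j ^+ n = 1.
Proof.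
move=> [sep _] Hu Bu; rewrite -!coordX // => un1.
suff -> : u ^+ n = 1 by rewrite coord1.
apply/eqP; apply: implyP (forallP (forall_inP sep (u ^+ n) _) i) _.
  by rewrite inE !groupX.
by rewrite un1.
Qed.

Lemma diag_inj (H : {group W}) i :
  diag_type H -> {in H :&: base &, injective (coord^~ i)}.
Proof.
move=> [sep _] u v HBu HBv /= euv; apply/eqP; rewrite eq_mulgV1.
have HBuv : u * v^-1 \in H :&: base by rewrite groupM ?groupV.
apply: implyP (forallP (forall_inP sep _ HBuv) i) _.
have [_ Bu] := setIP HBu; have [_ Bv] := setIP HBv.
by rewrite -coord_homE morphM ?morphV ?groupV // coord_homE euv mulgV.
Qed.

Lemma diag_socle (H : {group W}) :
  diag_type H -> coord_hom o0 @* (H :&: socle) = A5 /\ #|H :&: socle| = 60.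
Proof.
move=> dH; have [_ onto] := dH.
have sNB : H :&: socle \subset base by rewrite subIset // socle_base orbT.
have im : coord_hom o0 @* (H :&: socle) = A5.
  apply/eqP; rewrite eqEsubset; apply/andP; split; apply/subsetP.
    by move=> _ /morphimP[k _ /setIP[_ Nk] ->]; apply: coord_socle.
  by move=> _ /onto[k Kk <-]; rewrite -coord_homE mem_morphim // (subsetP sNB).
split=> //; rewrite -card_A5 -im morphimEsub // card_in_imset //.
move=> u v Ku Kv; apply: (diag_inj dH) => //; rewrite inE.
  by rewrite (subsetP sNB) // andbT; case/setIP: Ku.
by rewrite (subsetP sNB) // andbT; case/setIP: Kv.
Qed.

(** Quotients of two such elements lie in the trace of H on the socle. *)
Lemma diag_coset (H : {group W}) b : H \subset G -> diag_type H ->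
  #|[set g in H | (top g == rot3) && (parity g == b)]| <= 60.
Proof.
move=> sHG dH; have [_ <-] := diag_socle dH.
apply: (@leq_card_divl _ _ (H :&: socle)%G) => u v.
rewrite !inE => /and3P[Hu /eqP us /eqP pu] /and3P[Hv /eqP vs /eqP pv].
rewrite groupM ?groupV //=; have /mem_A5cube6P[_ eu] := subsetP sHG u Hu.
have /mem_A5cube6P[_ ev] := subsetP sHG v Hv; rewrite topM topV us vs mulgV eqxx /=.
by apply/forallP=> i; rewrite coordM coordV odd_permM odd_permV eu ev pu pv addbb.
Qed.

(** The return of [g] is not of order 6.  The trace K of H on the socle is a
    copy of A5, which has at most six Sylow 5-subgroups, and [g] permutes them
    by conjugation.  So some [g ^+ m] with [0 < m <= 6] normalises one of them,
    say P, and then so does [(g ^+ 3) ^+ (2 * m')] for some m' prime to 3.  Its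
    coordinate at 0 is a power of the return with exponent 2 * m', has order
    dividing 3 and normalises a Sylow 5-subgroup of S5, so it is trivial by
    [norm_Syl_order3]. *)
Lemma diag_cube (H : {group W}) g :
    H \subset G -> diag_type H -> g \in H -> top g = rot3 ->
  coord (g ^+ 3) o0 ^+ 6 = 1 -> coord (g ^+ 3) o0 ^+ 2 = 1.
Proof.
move=> sHG dH Hg gs; set x := coord _ _ => x6.
have [imK oK] := diag_socle dH; pose K := (H :&: socle)%G.
have Bg3 : g ^+ 3 \in base by apply/baseP; apply: top_cube.
have nKg : g \in 'N(K).
  by apply: (subsetP (normsI (normG H) _)) => //; apply/subsetP=> h _; apply: socle_norm.
have [P sylP] := Sylow_exists 5 K.
have oP : #|P| = 5 by rewrite (card_Hall sylP) oK p_part; vm_compute.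
(* The index of the normaliser of P in the cyclic group of [g] is the size
   of the orbit of P. *)
have [m m_gt0 /andP[le_m6 nPgm]] : exists2 m, 0 < m & (m <= 6) && (g ^+ m \in 'N(P)).
  pose M := 'N_<[g]>(P)%G; exists #|<[g]> : M| => //; apply/andP; split.
    have <- : #|orbit 'JG <[g]> P| = #|<[g]> : M|.
      by rewrite card_orbit astab1JG.
    apply: leq_trans (_ : #|'Syl_5(K)| <= 6); last first.
      by case: (@card_Syl5_mod _ K); rewrite ?oK // => ->.
    apply: subset_leq_card; apply/subsetP=> _ /orbitP[h ch <-].
    rewrite inE /= pHallJnorm //.
    by apply: (subsetP _ h ch); rewrite cycle_subG.
  have nMg : M <| <[g]> by rewrite -sub_abelian_normal ?subsetIl ?cycle_abelian.
  have gN : g \in 'N(M) by rewrite (subsetP (normal_norm nMg)) ?cycle_id.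
  have : coset M g ^+ #|<[g]> / M| = 1.
    by apply: expg_cardG; rewrite mem_quotient ?cycle_id.
  rewrite card_quotient ?normal_norm // -morphX // => /coset_idr.
  by rewrite groupX // => /(_ isT) /setIP[].
(* Take m' = m if 3 does not divide m, and m' = 1 otherwise: then m divides
   6 * m'. *)
have [m' m'3 nPgm'] : exists2 m', ~~ (3 %| m') & g ^+ (3 * (2 * m')) \in 'N(P).
  case: m m_gt0 le_m6 nPgm => [|[|[|[|[|[|[|//]]]]]]] // _ _ nP.
  - by exists 1%N => //; have := groupX 6 nP; rewrite -expgM.
  - by exists 2%N => //; have := groupX 6 nP; rewrite -expgM.
  - by exists 1%N => //; have := groupX 2 nP; rewrite -expgM.
  - by exists 4%N => //; have := groupX 6 nP; rewrite -expgM.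
  - by exists 5%N => //; have := groupX 6 nP; rewrite -expgM.
  - by exists 1%N => //.
rewrite expgM in nPgm'.
have Bh : (g ^+ 3) ^+ (2 * m') \in base by apply: groupX.
have sPB : P \subset base.
  apply: subset_trans (pHall_sub sylP) (subset_trans (subsetIr _ _) socle_base).
have nP0 : x ^+ (2 * m') \in 'N(coord_hom o0 @* P).
  rewrite -coordX // -coord_homE; apply: (subsetP (morphim_norm _ _)).
  by rewrite mem_morphim.
have sylP0 : (coord_hom o0 @* P)%G \in Syl5.
  rewrite mem_Syl /= morphimEsub // card_in_imset ?oP // => u v Pu Pv.
  have PK w : w \in P -> w \in H :&: base.
    move=> Pw; have /setIP[Hw Nw] := subsetP (pHall_sub sylP) w Pw.
    by rewrite inE Hw (subsetP socle_base).
  by apply: (diag_inj dH); apply: PK.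
have x3 : (x ^+ (2 * m')) ^+ 3 = 1.
  by rewrite -expgM mulnAC (expgM x 6) x6 expg1n.
have x2m := norm_Syl_order3 sylP0 nP0 x3.
have d3 : #[x ^+ 2] %| 3 by rewrite order_dvdn -expgM x6.
have dm : #[x ^+ 2] %| m' by rewrite order_dvdn -expgM x2m.
apply/eqP; rewrite -order_eq1; move: d3 dm; rewrite (dvdn_divisors _ (isT : 0 < 3)).
by rewrite !inE => /orP[// | /eqP ->]; rewrite (negPf m'3).
Qed.

(** * Elements that lie in few proper subgroups *)

Definition point5 i (lt_i5 : i < 5) : 'I_5 := Ordinal lt_i5.
Local Notation "''p_' i" := (@point5 i isT) (at level 2, i at level 2, format "''p_' i").

(** Cycle type 3+2. *)
Definition x6 := tperm 'p_0 'p_1 * tperm 'p_1 'p_2 * tperm 'p_3 'p_4.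
(** Cycle type 4+1. *)
Definition y4 := tperm 'p_0 'p_1 * tperm 'p_1 'p_2 * tperm 'p_2 'p_3.

Lemma code_x6 : code x6 = [:: 2; 0; 1; 4; 3]%N.
Proof. by rewrite !codeM !code_tperm; vm_compute. Qed.
Lemma code_y4 : code y4 = [:: 3; 0; 1; 2; 4]%N.
Proof. by rewrite !codeM !code_tperm; vm_compute. Qed.

Lemma odd_x6 : odd_perm x6. Proof. by rewrite odd_code code_x6; vm_compute. Qed.
Lemma odd_y4 : odd_perm y4. Proof. by rewrite odd_code code_y4; vm_compute. Qed.

Lemma odd_permX (x : {perm 'I_5}) n : odd_perm (x ^+ n) = odd n && odd_perm x.
Proof.
elim: n => [|n IHn]; first by rewrite expg0 odd_perm1.
by rewrite expgS odd_permM IHn /=; case: (odd n); case: (odd_perm x).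
Qed.

Lemma code_exp x n : code (x ^+ n) = iter n (mulc (code x)) (iota 0 5).
Proof. by elim: n => [|n IHn]; rewrite ?expg0 ?code1 // expgS codeM IHn. Qed.

Lemma x6_order6 : x6 ^+ 6 = 1.
Proof. by apply: code_inj; rewrite code_exp code_x6 code1; vm_compute. Qed.
Lemma x6_expg n : n \in [:: 2; 4] -> x6 ^+ n != 1.
Proof.
by move=> n24; rewrite -(inj_eq code_inj) code_exp code_x6 code1; move: n24;
  rewrite !inE => /orP[] /eqP ->; vm_compute.
Qed.
Lemma y4_order4 : y4 ^+ 4 = 1.
Proof. by apply: code_inj; rewrite code_exp code_y4 code1; vm_compute. Qed.

Definition pair0 : {set 'I_5} := [set 'p_3; 'p_4].

Lemma fix_point_code x (O : {set 'I_5}) : #|O| = 1%N -> x \in 'N(O | 'P) ->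
  has (fun a => nth 0 (code x) a == a) (iota 0 5).
Proof.
move=> /eqP/cards1P[i ->] nOx; apply/hasP; exists (val i).
  by rewrite mem_iota /= ltn_ord.
have := astabs_act i nOx; rewrite !inE eqxx nth_code => /eqP xi.
by rewrite val_eqE; apply/eqP.
Qed.

Lemma x6_no_point (O : {set 'I_5}) : #|O| = 1%N -> x6 \notin 'N(O | 'P).
Proof. by move=> o1; apply/negP=> /(fix_point_code o1); rewrite code_x6. Qed.

Lemma x6_pair (O : {set 'I_5}) : #|O| = 2 -> x6 \in 'N(O | 'P) -> O = pair0.
Proof.
move=> /eqP/cards2P[i [j [neq_ij ->]]]; rewrite fix_pair_code code_x6.
pose Q a b := (a != b) && codes_pair_fix [:: 2; 0; 1; 4; 3]%N a b ==>
  ((a == 3) && (b == 4)) || ((a == 4) && (b == 3)).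
have /all_ord5/(_ i)/all_ord5/(_ j) : all (fun a => all (Q a) (iota 0 5)) (iota 0 5).
  by vm_compute.
rewrite /Q neq_ij /= => /implyP e /e /orP[] /andP[/eqP i3 /eqP j4].
  by congr [set _; _]; apply: val_inj.
by rewrite setUC; congr [set _; _]; apply: val_inj.
Qed.

Lemma x6_pair0 : x6 \in 'N(pair0 | 'P).
Proof. by rewrite fix_pair_code code_x6. Qed.

Lemma y4_no_pair (O : {set 'I_5}) : #|O| = 2 -> y4 \notin 'N(O | 'P).
Proof.
move=> /eqP/cards2P[i [j [neq_ij ->]]]; rewrite fix_pair_code code_y4.
pose Q a b := (a != b) ==> ~~ codes_pair_fix [:: 3; 0; 1; 2; 4]%N a b.
have /all_ord5/(_ i)/all_ord5/(_ j) : all (fun a => all (Q a) (iota 0 5)) (iota 0 5).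
  by vm_compute.
by rewrite /Q neq_ij.
Qed.

(** Its square has order 3. *)
Lemma x6_no_Syl (P : {group {perm 'I_5}}) : P \in Syl5 -> x6 \notin 'N(P).
Proof.
move=> sylP; apply/negP=> nPx; have /eqP := @x6_expg 2 isT; apply.
by apply: (norm_Syl_order3 sylP); rewrite ?groupX // -expgM x6_order6.
Qed.

(** Swapping the two elements of the 2-subset first corrects the parity. *)
Lemma A5_trans_pairs (O : {set 'I_5}) : #|O| = 2 ->
  exists2 a, a \in A5 & subset_act pair0 a = O.
Proof.
move=> /eqP/cards2P[i [j [neq_ij ->]]].
pose t := tperm 'p_3 i; pose a := t * tperm (t 'p_4) j.
have a3 : a 'p_3 = i.
  rewrite permM tpermL tpermD // 1?eq_sym //.
  by apply: contraNneq (isT : 'p_3 != 'p_4) => it; rewrite -(inj_eq (@perm_inj _ t)) tpermL it.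
have a4 : a 'p_4 = j by rewrite permM tpermL.
have acts (b : {perm 'I_5}) : b 'p_3 = i -> b 'p_4 = j -> subset_act pair0 b = [set i; j].
  by move=> b3 b4; rewrite /= setactE imsetU1 imset_set1 /= /aperm b3 b4.
have [odd_a | even_a] := boolP (odd_perm a); last first.
  by exists a; [rewrite Alt_even | apply: acts].
exists (tperm 'p_3 'p_4 * a); first by rewrite Alt_even odd_permM odd_tperm odd_a.
rewrite -[RHS](acts a) // actM; congr (subset_act _ a).
by rewrite /= setactE imsetU1 imset_set1 /= /aperm tpermL tpermR setUC.
Qed.

(** The return is [x6 ^+ 7], that is [x6]; all three coordinates are odd and
    stabilise [pair0]. *)
Definition g0 := wreath_elt rot3 (fun i => if i == o1 then x6 else x6 ^+ 3).

Lemma parity_g0 : parity g0.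
Proof. by rewrite /parity coord_wreath_elt /= odd_permX odd_x6. Qed.

Lemma g0_G : g0 \in G.
Proof.
apply/mem_A5cube6P; split; first by apply/Alt3P; apply: Or32.
by rewrite parity_g0; apply: ord3P; rewrite coord_wreath_elt /= ?odd_permX odd_x6.
Qed.

Lemma coord_g0_cube : coord (g0 ^+ 3) o0 = x6.
Proof.
by rewrite coord_cube // !coord_wreath_elt /= -expgS -expgD expgSr (x6_order6 : x6 ^+ 6 = 1) mul1g.
Qed.

Definition pairs0 : {ffun 'I_3 -> {set 'I_5}} := [ffun=> pair0].

Lemma g0_fix (t : {ffun 'I_3 -> {set 'I_5}}) :
  (forall i, #|t i| = 2) -> g0 \in 'C[t | triple_act subset_act] -> t = pairs0.
Proof.
move=> ot fix_g0; have [t1 t2 _ t0] := triple_fix_rot (erefl : top g0 = rot3) fix_g0.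
have fx0 : x6 \in 'C[pair0 | subset_act] by rewrite astab1_set x6_pair0.
have t0P : t o0 = pair0.
  by apply: x6_pair => //; rewrite -astab1_set; apply/astab1P; rewrite -[x6]coord_g0_cube.
rewrite t0P coord_wreath_elt (astab1P fx0) in t1.
rewrite t1 coord_wreath_elt (astab1P (groupX 3 fx0)) in t2.
by apply/ffunP; apply: ord3P; rewrite ffunE.
Qed.

(** An element of order 6 of S5 fixes a unique 2-subset, no point and no Sylow
    5-subgroup, and [diag_cube] excludes the diagonal case. *)
Lemma g0_type (H : {group W}) : H \proper G -> g0 \in H -> fixes H pairs0 subset_act.
Proof.
move=> prH Hg0; have gs : top g0 = rot3 by [].
have [] := trichotomy prH Hg0 gs parity_g0.
- case=> t ot fixt; have [_ _ _ t0] := triple_fix_rot gs (subsetP fixt _ Hg0).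
  case/negP: (x6_no_point (ot o0)); rewrite -astab1_set; apply/astab1P.
  by rewrite -[x6]coord_g0_cube.
- by case=> t ot fixt; rewrite -(g0_fix ot (subsetP fixt _ Hg0)).
- case=> t ot fixt; have [_ _ _ t0] := triple_fix_rot gs (subsetP fixt _ Hg0).
  case/negP: (x6_no_Syl (ot o0)); rewrite -astab1JG; apply/astab1P.
  by rewrite -[x6]coord_g0_cube.
- move=> dH; have := diag_cube (proper_sub prH) dH Hg0 gs.
  by rewrite coord_g0_cube => /(_ x6_order6)/eqP; rewrite (negPf (@x6_expg 2 isT)).
Qed.

(** Conjugates of [g0] under the socle, which is transitive on the triples of
    2-subsets. *)
Lemma pair_witness (t : {ffun 'I_3 -> {set 'I_5}}) : (forall i, #|t i| = 2) ->
  exists g, [/\ g \in G,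
    forall H : {group W}, H \proper G -> g \in H -> fixes H t subset_act
  & forall t' : {ffun 'I_3 -> {set 'I_5}}, (forall i, #|t' i| = 2) ->
      g \in 'C[t' | triple_act subset_act] -> t' = t].
Proof.
move=> ot; have [a Aa pa] := fin_all_exists2 (fun i => A5_trans_pairs (ot i)).
pose u := wreath_elt 1 a.
have Nu : u \in socle.
  by apply/socleP; split=> // i; rewrite coord_wreath_elt; apply/negbTE; rewrite -Alt_even.
have Gu : u \in G.
  by apply/mem_A5cube6P; split=> [|i]; rewrite /parity ?group1 // !(proj2 (socleP _ Nu)).
have tu : triple_act subset_act pairs0 u = t.
  by apply/ffunP=> i; rewrite !ffunE coord_wreath_elt.
exists (g0 ^ u); split; first by rewrite groupJ ?g0_G.
  move=> H prH Hg; have prH' : (H :^ u^-1)%G \proper G.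
    by rewrite /= -(conjGid (groupVr Gu)) properJ.
  have := g0_type prH'; rewrite /= mem_conjgV => /(_ Hg).
  by rewrite sub_conjgV -astab1_act tu.
move=> t' ot' fix_t'; rewrite -tu; apply: (canRL (actKV (triple_act subset_act) u)).
apply: g0_fix; last by rewrite astab1_act mem_conjgV.
by move=> i; rewrite ffunE /= setactE card_imset //; apply: act_inj.
Qed.

Definition u0 := wreath_elt 1 (fun i => if i == o0 then y4 else x6).

Lemma u0_G : u0 \in G.
Proof.
apply/mem_A5cube6P; split; first exact: group1.
by apply: ord3P; rewrite /parity !coord_wreath_elt /= ?odd_x6 odd_y4.
Qed.

(** Coordinate 1 has order 6 and fixes no point and no Sylow 5-subgroup;
    coordinate 0 is a 4-cycle and fixes no 2-subset.  In a diagonal subgroup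
    these two coordinates would have the same order. *)
Lemma u0_type (H : {group W}) g :
  H \proper G -> g \in H -> top g = rot3 -> parity g -> u0 \notin H.
Proof.
move=> prH Hg gs odd_g; apply/negP=> Hu.
have u01 : top u0 = 1 by [].
have [] := trichotomy prH Hg gs odd_g.
- case=> t ot fixt; have /triple_fixP/(_ o1) := subsetP fixt _ Hu.
  rewrite u01 perm1 coord_wreath_elt /= => t1; case/negP: (x6_no_point (ot o1)).
  by rewrite -astab1_set; apply/astab1P.
- case=> t ot fixt; have /triple_fixP/(_ o0) := subsetP fixt _ Hu.
  rewrite u01 perm1 coord_wreath_elt /= => t0; case/negP: (y4_no_pair (ot o0)).
  by rewrite -astab1_set; apply/astab1P.
- case=> t ot fixt; have /triple_fixP/(_ o1) := subsetP fixt _ Hu.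
  rewrite u01 perm1 coord_wreath_elt /= => t1; case/negP: (x6_no_Syl (ot o1)).
  by rewrite -astab1JG; apply/astab1P.
- move=> dH; have Bu : u0 \in base by apply/baseP.
  have := @diag_expg H u0 o0 o1 4 dH Hu Bu.
  rewrite !coord_wreath_elt /= => /(_ y4_order4)/eqP.
  by rewrite (negPf (@x6_expg 4 isT)).
Qed.

(** * Rotating elements that fix a triple of Sylow 5-subgroups *)

(** The conditions on the three coordinates are independent, so that such sets
    are counted by [card_rot_family]. *)
Definition rot_family (F : 'I_3 -> {set {perm 'I_5}}) : {set W} :=
  [set g | (top g == rot3) && [forall i, coord g i \in F i]].

Lemma rot_familyP (F : 'I_3 -> {set {perm 'I_5}}) g :
  reflect (top g = rot3 /\ forall i, coord g i \in F i) (g \in rot_family F).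
Proof.
rewrite inE; apply: (iffP andP) => -[].
  by move=> /eqP gs /forallP Fg.
by move=> -> Fg; split=> //; apply/forallP.
Qed.

Definition rot_elt (abc : {perm 'I_5} * {perm 'I_5} * {perm 'I_5}) : W :=
  wreath_elt rot3
    (fun i => if i == o0 then abc.1.1 else if i == o1 then abc.1.2 else abc.2).

Lemma rot_elt_inj : injective rot_elt.
Proof.
move=> [[a b] c] [[a' b'] c'] e; have co_e i := congr1 (fun g => coord g i) e.
by have := co_e o0; have := co_e o1; have := co_e o2; rewrite !coord_wreath_elt /= => -> -> ->.
Qed.

Lemma card_rot_family (F : 'I_3 -> {set {perm 'I_5}}) :
  #|rot_family F| = (#|F o0| * #|F o1| * #|F o2|)%N.
Proof.
rewrite -!cardsX -(card_imset _ rot_elt_inj); apply: eq_card => g.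
apply/rot_familyP/imsetP => [[gs Fg] | [[[a b] c]]].
  exists (coord g o0, coord g o1, coord g o2); first by rewrite !inE !Fg.
  by apply: wreath_eq => //; apply: ord3P; rewrite coord_wreath_elt.
rewrite !inE /= -andbA => /and3P[Fa Fb Fc] ->; split=> //.
by apply: ord3P; rewrite coord_wreath_elt.
Qed.

Local Notation Syl_triple := {ffun 'I_3 -> {group {perm 'I_5}}}.
Definition Syl_triples : {set Syl_triple} :=
  [set v : Syl_triple | [forall i, v i \in Syl5]].

Lemma Syl_triplesP (v : Syl_triple) : reflect (forall i, v i \in Syl5) (v \in Syl_triples).
Proof. by rewrite inE; apply: forallP. Qed.

Lemma card_Syl_triples : #|Syl_triples| = 216.
Proof.
have -> : #|Syl_triples| = #|(ffun_on (mem Syl5) : {pred Syl_triple})|.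
  by apply: eq_card => v; apply/Syl_triplesP/ffun_onP.
by rewrite card_ffun_on card_Syl6 card_ord.
Qed.

(** The elements of one coset of the socle (top component [rot3], parity [b])
    that fix the triple [v]. *)
Definition fixers b (v : Syl_triple) : {set W} :=
  [set g | [&& g \in G, top g == rot3, parity g == b & g \in 'C[v | triple_act syl_act]]].

Lemma fixersP b (v : Syl_triple) g :
  reflect [/\ g \in G, top g = rot3, parity g = b & g \in 'C[v | triple_act syl_act]]
          (g \in fixers b v).
Proof.
have -> : (g \in fixers b v) = [&& g \in G, top g == rot3, parity g == b
    & g \in 'C[v | triple_act syl_act]] := in_set _ _.
by apply: (iffP and4P) => -[? /eqP ? /eqP ? ?]; split=> //; apply/eqP.
Qed.

(** To fix [v] is a condition on each coordinate separately: coordinate [i]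
    transports the entry before [i] to the entry at [i]. *)
Lemma fixers_family b (v : Syl_triple) :
  fixers b v = rot_family (fun i => transporter syl_act b (v (rot3^-1 i)) (v i)).
Proof.
apply/setP=> g; apply/fixersP/rot_familyP => [[Gg gs pg /triple_fixP vg] | [gs vg]].
  split=> // i; have /mem_A5cube6P[_ odd_g] := Gg; apply/transporterP; rewrite odd_g; split=> //.
  by have := vg (rot3^-1 i); rewrite gs permKV.
have odd_g i : odd_perm (coord g i) = b by have /transporterP[] := vg i.
split; [|exact: gs|exact: odd_g|].
  by apply/mem_A5cube6P; split=> [|i]; [apply/Alt3P; apply: Or32 | rewrite /parity !odd_g].
apply/triple_fixP=> i; have /transporterP[_ <-] := vg (top g i).
by rewrite gs permK.
Qed.

Lemma card_fixers b v : v \in Syl_triples -> 1000 <= #|fixers b v|.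
Proof.
move=> /Syl_triplesP sylv; rewrite fixers_family card_rot_family.
have le10 i := card_transporter_Syl b (sylv (rot3^-1 i)) (sylv i).
exact: leq_mul (leq_mul (le10 o0) (le10 o1)) (le10 o2).
Qed.

(** Each coordinate has two transport conditions to satisfy, and
    [card_transporterI] leaves at most two choices. *)
Lemma card_fixers_sub (X : finType) (to : {action {perm 'I_5} &-> X})
    (H : {set W}) b v (t : {ffun 'I_3 -> X}) :
    v \in Syl_triples -> fixes H t to -> (forall i, ~~ (v i \subset 'C[t i | to])) ->
  #|H :&: fixers b v| <= 8.
Proof.
move=> /Syl_triplesP sylv fixt nfix.
pose F i := transporter syl_act b (v (rot3^-1 i)) (v i) :&: transporter to b (t (rot3^-1 i)) (t i).
apply: leq_trans (_ : #|rot_family F| <= 8); last first.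
  have le2 i : #|F i| <= 2 by apply: card_transporterI.
  by rewrite card_rot_family; apply: leq_mul (leq_mul (le2 o0) (le2 o1)) (le2 o2).
apply/subset_leq_card/subsetP=> g /setIP[Hg]; rewrite fixers_family.
case/rot_familyP=> gs vg; apply/rot_familyP; split=> // i.
rewrite inE vg /=; apply/transporterP; have /transporterP[-> _] := vg i; split=> //.
by have /triple_fixP/(_ (rot3^-1 i)) := subsetP fixt g Hg; rewrite gs permKV.
Qed.

(** A fixed triple is determined by any one of its entries. *)
Lemma fixed_triple_eq (X : finType) (to : {action {perm 'I_5} &-> X})
    (t t' : {ffun 'I_3 -> X}) g i :
  top g = rot3 -> g \in 'C[t | triple_act to] -> g \in 'C[t' | triple_act to] ->
  t i = t' i -> t = t'.
Proof.
move=> gs gt gt'; have [t1 t2 t0 _] := triple_fix_rot gs gt.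
have [t1' t2' t0' _] := triple_fix_rot gs gt'.
have all0 : t o0 = t' o0 -> t = t'.
  by move=> e0; apply/ffunP; apply: ord3P => //; rewrite ?t2 ?t2' t1 t1' e0.
by move: i; apply: ord3P => // e; apply: all0;
  [rewrite t0 t0' t2 t2' e | rewrite t0 t0' e].
Qed.

Lemma fixers_cube (v : Syl_triple) g :
  g \in fixers true v -> coord (g ^+ 3) o0 \in 'N(v o0) /\ odd_perm (coord (g ^+ 3) o0).
Proof.
case/fixersP=> Gg gs pg fixv; have [_ _ _ /= v0] := triple_fix_rot gs fixv.
split; first by rewrite -astab1JG; apply/astab1P.
have /mem_A5cube6P[_ odd_g] := Gg.
by rewrite coord_cube // !odd_permM !odd_g pg.
Qed.

Lemma fixers_pair_type (H : {group W}) v g :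
  v \in Syl_triples -> g \in fixers true v -> subset_type 2 H -> g \notin H.
Proof.
move=> /Syl_triplesP sylv fixg [t ot fixt]; apply/negP=> Hg.
have [Gg gs pg _] := fixersP _ _ _ fixg.
have [nx odd_x] := fixers_cube fixg.
have [_ _ _ t0] := triple_fix_rot gs (subsetP fixt g Hg).
case/negP: (odd_norm_Syl_pair (sylv o0) nx odd_x (ot o0)).
by rewrite -astab1_set; apply/astab1P.
Qed.

(** The return of an element of [fixers true v] is a 4-cycle, which rules out
    triples of 2-subsets. *)
Lemma fixers_trichotomy (H : {group W}) v g :
    H \proper G -> v \in Syl_triples -> g \in H -> g \in fixers true v ->
  [\/ subset_type 1 H, syl_type H | diag_type H].
Proof.
move=> prH Tv Hg fixg; have [Gg gs pg _] := fixersP _ _ _ fixg.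
have [T|T|T|T] := trichotomy prH Hg gs pg; first by apply: Or31.
- by have := fixers_pair_type Tv fixg T; rewrite Hg.
- by apply: Or32.
- by apply: Or33.
Qed.

(** The even elements that fix [v] and have a 5-cycle as return. *)
Definition fixers5 (v : Syl_triple) : {set W} :=
  [set g in fixers false v | (coord (g ^+ 3) o0 \in v o0) && (coord (g ^+ 3) o0 != 1)].

Lemma fixers5P (v : Syl_triple) g :
  reflect [/\ g \in fixers false v, coord (g ^+ 3) o0 \in v o0 & coord (g ^+ 3) o0 != 1]
          (g \in fixers5 v).
Proof.
have -> : (g \in fixers5 v) = [&& g \in fixers false v, coord (g ^+ 3) o0 \in v o0
    & coord (g ^+ 3) o0 != 1] := in_set _ _.
exact: and3P.
Qed.

(** Coordinates 1 and 2 can be chosen freely in their transporters, and the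
    return as any of the four 5-cycles in [v o0]; this determines
    coordinate 0. *)
Lemma card_fixers5 v : v \in Syl_triples -> 400 <= #|fixers5 v|.
Proof.
move=> /Syl_triplesP sylv.
pose T i := transporter syl_act false (v (rot3^-1 i)) (v i).
have le10 i : 10 <= #|T i| := card_transporter_Syl false (sylv (rot3^-1 i)) (sylv i).
pose D := setX (setX (T o1) (T o2)) (v o0)^#.
pose f (abx : {perm 'I_5} * {perm 'I_5} * {perm 'I_5}) :=
  rot_elt ((abx.1.1 * abx.1.2)^-1 * abx.2, abx.1.1, abx.1.2).
have inj_f : injective f.
  move=> [[a b] x] [[a' b'] x'] /rot_elt_inj /= [e ea eb].
  by move: e; rewrite ea eb => /mulgI ->.
have o5 : #|(v o0)^#| = 4.
  have := cardsD1 1 (v o0); rewrite group1; have := sylv o0.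
  by rewrite mem_Syl => /eqP -> [].
apply: leq_trans (_ : #|D| <= _).
  by rewrite !cardsX o5; apply: leq_mul (leq_mul (le10 o1) (le10 o2)) (leqnn 4).
rewrite -(card_imset _ inj_f); apply/subset_leq_card/subsetP=> _ /imsetP[[[a b] x] Dabx ->].
have [/setXP[Ta Tb] /setD1P[ntx Vx]] := setXP Dabx.
have gs : top (f (a, b, x)) = rot3 by [].
have x_co : coord (f (a, b, x) ^+ 3) o0 = x by rewrite coord_cube // !coord_wreath_elt /= mulKVg.
have /transporterP[odd_a va] := Ta; have /transporterP[odd_b vb] := Tb.
rewrite !rot3VE in va vb.
apply/fixers5P; rewrite x_co; split=> //; rewrite fixers_family; apply/rot_familyP.
split=> //; apply: ord3P; rewrite coord_wreath_elt //=.
apply/transporterP; rewrite rot3VE; split.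
  have := sylv o0; rewrite mem_Syl => /eqP/card5_sub_Alt/subsetP/(_ x Vx).
  by rewrite Alt_even odd_permM odd_permV odd_permM odd_a odd_b => /negbTE ->.
have -> : v o2 = syl_act (v o0) (a * b) by rewrite actM va vb.
rewrite actM actK; apply/astab1P; rewrite astab1JG.
exact: (subsetP (normG _)).
Qed.

(** * Weighing the members of a cover *)

Lemma double_count (I T : finType) (V : {set I}) (D : {set T}) (A : I -> {set T}) :
  \sum_(v in V) #|D :&: A v| = \sum_(g in D) #|[set v in V | g \in A v]|.
Proof.
have cardE (J : finType) (B : {set J}) (Q : pred J) :
    #|[set j in B | Q j]| = \sum_(j in B) Q j.
  rewrite -sum1_card [RHS]big_mkcond [LHS]big_mkcond; apply: eq_bigr => j _.
  by rewrite inE; case: (j \in B); case: (Q j).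
under eq_bigr do rewrite (cardE T D (fun g => g \in A _)).
by rewrite exchange_big; apply: eq_bigr => g _; rewrite cardE.
Qed.

(** Averaging: the sets A v have total size at least [m * #|V|], and each
    member of the cover accounts for at most [c] of it. *)
Lemma cover_count (I : finType) (gT : finGroupType) (V : {set I})
    (A : I -> {set gT}) (R : {set {group gT}}) m c :
    (forall v g, v \in V -> g \in A v -> exists2 H : {group gT}, H \in R & g \in H) ->
    (forall v, v \in V -> m <= #|A v|) ->
    (forall H : {group gT}, H \in R -> \sum_(v in V) #|H :&: A v| <= c) ->
  (m * #|V| <= c * #|R|)%N.
Proof.
move=> covA leA leH; apply: leq_trans (_ : \sum_(v in V) #|A v| <= _).
  by rewrite mulnC -sum_nat_const leq_sum.
apply: leq_trans (_ : \sum_(v in V) \sum_(H in R) #|H :&: A v| <= _).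
  apply: leq_sum => v Vv; under eq_bigr do rewrite setIC.
  rewrite double_count -sum1_card; apply: leq_sum => g Ag.
  have [H RH Hg] := covA v g Vv Ag; rewrite card_gt0; apply/set0Pn.
  by exists H; rewrite inE RH.
rewrite exchange_big /= mulnC -sum_nat_const.
exact: leq_sum.
Qed.

(** There are six possible entries at 0. *)
Lemma rot_fixed_triples b (V : {set Syl_triple}) g :
  V \subset Syl_triples -> #|[set v in V | g \in fixers b v]| <= 6.
Proof.
move=> /subsetP sV; rewrite -card_Syl6.
rewrite -(@card_in_imset _ _ (fun v : Syl_triple => v o0)).
  apply/subset_leq_card/subsetP=> _ /imsetP[v /setIdP[/sV/Syl_triplesP sylv _] ->].
  exact: sylv.
move=> v v' /setIdP[_ /fixersP[_ gs _ fixv]] /setIdP[_ /fixersP[_ _ _ fixv']].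
exact: fixed_triple_eq gs fixv fixv'.
Qed.

(** A 5-cycle normalises only one Sylow 5-subgroup. *)
Lemma fixers5_uniq v v' g :
  v \in Syl_triples -> v' \in Syl_triples -> g \in fixers5 v ->
  g \in 'C[v' | triple_act syl_act] -> v = v'.
Proof.
move=> /Syl_triplesP sylv /Syl_triplesP sylv' /fixers5P[fixg vx ntx] fixv'.
have [_ gs _ fixv] := fixersP _ _ _ fixg; apply: (fixed_triple_eq gs fixv fixv' (i := o0)).
apply: (order5_norm (sylv o0) (sylv' o0) vx ntx); rewrite -astab1JG.
by apply/astab1P; have [] := triple_fix_rot gs fixv'.
Qed.

(** Some triple of Sylow 5-subgroups that H fixes; when there is none, the
    value is the triple of trivial groups, which is not a Sylow triple. *)
Definition syl_label (H : {group W}) : Syl_triple :=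
  odflt [ffun=> 1%G] [pick v | (v \in Syl_triples) && fixes H v syl_act].

Lemma syl_labelP (H : {group W}) : syl_type H ->
  syl_label H \in Syl_triples /\ fixes H (syl_label H) syl_act.
Proof.
case=> t /Syl_triplesP sylt fixt; rewrite /syl_label; case: pickP => [v /andP[] //|].
by move/(_ t); rewrite sylt fixt.
Qed.

Lemma diag_sum (H : {group W}) b (V : {set Syl_triple}) (A : Syl_triple -> {set W}) k :
    H \subset G -> diag_type H -> (forall v, A v \subset fixers b v) ->
    (forall g, #|[set v in V | g \in A v]| <= k) ->
  \sum_(v in V) #|H :&: A v| <= 60 * k.
Proof.
move=> sHG dH sA lek; pose D := [set g in H | (top g == rot3) && (parity g == b)].
have -> : \sum_(v in V) #|H :&: A v| = \sum_(v in V) #|D :&: A v|.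
  apply: eq_bigr => v _; apply: eq_card => g; rewrite !in_setI.
  have [Ag | _] := boolP (g \in A v); last by rewrite !andbF.
  have /fixersP[_ gs pg _] := subsetP (sA v) g Ag.
  by rewrite [g \in D]inE gs pg !eqxx !andbT.
rewrite double_count; apply: leq_trans (_ : \sum_(g in D) k <= _).
  exact: leq_sum.
by rewrite sum_nat_const leq_mul2r diag_coset // orbT.
Qed.

Section SylowWeights.
Context (R : {set {group W}}).
Context (prR : forall H : {group W}, H \in R -> H \proper G).
Context (meetR : forall H : {group W}, H \in R ->
  exists2 v, v \in Syl_triples & exists2 g, g \in H & g \in fixers true v).

(** The members of R use up at most [#|R|] triples as labels; the weights are
    taken over the remaining ones.  A Sylow-type member is thereby compared
    only with triples other than its own label. *)
Definition unlabelled := Syl_triples :\: syl_label @: R.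

Lemma card_unlabelled : 216 - #|R| <= #|unlabelled|.
Proof.
rewrite cardsD card_Syl_triples leq_sub2l //.
by rewrite (leq_trans (subset_leq_card (subsetIr _ _))) ?leq_imset_card.
Qed.

Lemma unlabelledP v : v \in unlabelled ->
  v \in Syl_triples /\ forall H, H \in R -> v != syl_label H.
Proof.
case/setDP=> Tv nRv; split=> // H RH; apply: contraNneq nRv => ->.
exact: imset_f.
Qed.

Lemma member_type (H : {group W}) : H \in R ->
  [\/ subset_type 1 H, syl_type H | diag_type H].
Proof.
move=> RH; have [v Tv [g Hg fixg]] := meetR RH.
exact: fixers_trichotomy (prR RH) Tv Hg fixg.
Qed.

(** Point-type and Sylow-type members have at most 2^3 elements in common with
    each set of fixers.  A diagonal member has at most 60 elements in the
    coset, each of which fixes at most six triples, and 60 * 6 = 8 * 45. *)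
Lemma odd_weight (H : {group W}) : H \in R -> 45 <= #|unlabelled| ->
  \sum_(v in unlabelled) #|H :&: fixers true v| <= 8 * #|unlabelled|.
Proof.
move=> RH le45; have sHG := proper_sub (prR RH).
case: (member_type RH) => [[t ot fixt] | sylH | dH].
- rewrite mulnC -sum_nat_const; apply: leq_sum => v /unlabelledP[Tv _].
  apply: (card_fixers_sub _ Tv fixt) => i; rewrite astab1_set.
  by apply: Syl_moves_set; rewrite ?ot //; apply: (Syl_triplesP _ Tv).
- have [Tt fixt] := syl_labelP sylH.
  rewrite mulnC -sum_nat_const; apply: leq_sum => v /unlabelledP[Tv /(_ H RH) neq_v].
  have [-> | [g /setIP[Hg fixg]]] := set_0Vmem (H :&: fixers true v).
    by rewrite cards0.
  apply: (card_fixers_sub _ Tv fixt) => i; rewrite astab1JG.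
  have /Syl_triplesP sylv := Tv; have /Syl_triplesP sylt := Tt.
  apply: contra neq_v => /(Syl_norm_Syl (sylv i) (sylt i)) eq_i; apply/eqP.
  have [_ gs _ fixv] := fixersP _ _ _ fixg.
  exact: fixed_triple_eq gs fixv (subsetP fixt g Hg) eq_i.
- apply: leq_trans (_ : 60 * 6 <= _); last by lia.
  apply: (diag_sum sHG dH) => // g; apply: rot_fixed_triples.
  exact: subsetDl.
Qed.

(** A 5-cycle fixes no point and only one Sylow 5-subgroup, so only diagonal
    members contribute. *)
Lemma even_weight (H : {group W}) : H \in R ->
  \sum_(v in unlabelled) #|H :&: fixers5 v| <= 60.
Proof.
move=> RH; have sHG := proper_sub (prR RH).
have load0 : (forall v g, v \in unlabelled -> g \in H -> g \in fixers5 v -> False) ->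
    \sum_(v in unlabelled) #|H :&: fixers5 v| <= 60.
  move=> no; rewrite big1 // => v Vv; apply/eqP; rewrite cards_eq0 -subset0.
  by apply/subsetP=> g /setIP[Hg fixg]; case: (no v g).
case: (member_type RH) => [[t ot fixt] | sylH | dH].
- apply: load0 => v g /unlabelledP[/Syl_triplesP sylv _] Hg /fixers5P[fixg vx ntx].
  have [_ gs _ _] := fixersP _ _ _ fixg.
  have := order5_set (O := t o0) (sylv o0) vx ntx; rewrite ot => /(_ isT) /negP[].
  rewrite -astab1_set; apply/astab1P.
  by have [] := triple_fix_rot gs (subsetP fixt g Hg).
- have [Tt fixt] := syl_labelP sylH.
  apply: load0 => v g /unlabelledP[Tv /(_ H RH) /eqP neq_v] Hg fixg.
  by apply: neq_v; apply: fixers5_uniq fixg (subsetP fixt g Hg).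
- rewrite -[60]/(60 * 1)%N; apply: (diag_sum (b := false) sHG dH).
    by move=> v; apply/subsetP=> g /fixers5P[].
  move=> g; apply/card_le1_eqP=> v v' /setIdP[/unlabelledP[Tv _] fixv].
  case/setIdP=> /unlabelledP[Tv' _] /fixers5P[/fixersP[_ _ _ fixv'] _ _].
  exact/esym/(fixers5_uniq Tv Tv' fixv).
Qed.
(** With fewer than 125 members, at least 92 triples are unlabelled, and
    [odd_weight] would give 1000 <= 8 * 124. *)
Lemma odd_cover_bound :
    (forall v g, v \in Syl_triples -> g \in fixers true v ->
       exists2 H : {group W}, H \in R & g \in H) ->
  125 <= #|R|.
Proof.
move=> covR; rewrite leqNgt; apply/negP=> ltR.
have := card_unlabelled; set V := unlabelled => leV.
have V45 : 45 <= #|V| by lia.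
have : (1000 * #|V| <= 8 * #|V| * #|R|)%N.
  apply: (@cover_count _ _ V (fixers true)).
  - by move=> v g /unlabelledP[Tv _]; apply: covR.
  - by move=> v /unlabelledP[Tv _]; apply: card_fixers.
  - by move=> H RH; apply: odd_weight.
nia.
Qed.

(** With at most 125 members, at least 91 triples are unlabelled, and
    400 * 91 exceeds 60 * 125. *)
Lemma even_cover_bound :
    (forall v g, v \in Syl_triples -> g \in fixers5 v ->
       exists2 H : {group W}, H \in R & g \in H) ->
  126 <= #|R|.
Proof.
move=> covR; rewrite leqNgt; apply/negP=> ltR.
have := card_unlabelled; set V := unlabelled => leV.
have : (400 * #|V| <= 60 * #|R|)%N.
  apply: (@cover_count _ _ V fixers5).
  - by move=> v g /unlabelledP[Tv _]; apply: covR.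
  - by move=> v /unlabelledP[Tv _]; apply: card_fixers5.
  - by move=> H RH; apply: even_weight.
lia.
Qed.
End SylowWeights.

(** * The lower bound *)

Definition subset_triples n : {set {ffun 'I_3 -> {set 'I_5}}} :=
  [set t : {ffun 'I_3 -> {set 'I_5}} | [forall i, #|t i| == n]].

Lemma subset_triplesP n (t : {ffun 'I_3 -> {set 'I_5}}) :
  reflect (forall i, #|t i| = n) (t \in subset_triples n).
Proof. by rewrite inE; apply: (iffP 'forall_eqP). Qed.

Lemma card_subset_triples n : #|subset_triples n| = ('C(5, n) ^ 3)%N.
Proof.
pose D := [set O : {set 'I_5} | #|O| == n].
have -> : #|subset_triples n| = #|(ffun_on (mem D) : {pred {ffun 'I_3 -> {set 'I_5}}})|.
  apply: eq_card => t; apply/subset_triplesP/ffun_onP => ot i.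
    by rewrite inE ot.
  by have := ot i; rewrite inE => /eqP.
by rewrite card_ffun_on card_draws !card_ord.
Qed.

Lemma u0_pair_type (H : {group W}) : subset_type 2 H -> u0 \notin H.
Proof.
case=> t ot fixt; apply/negP=> Hu.
have /triple_fixP/(_ o0) := subsetP fixt _ Hu.
rewrite (erefl : top u0 = 1) perm1 coord_wreath_elt /= => t0; case/negP: (y4_no_pair (ot o0)).
by rewrite -astab1_set; apply/astab1P.
Qed.

Lemma fixers5_pair_type (H : {group W}) v g : v \in Syl_triples ->
  g \in fixers5 v -> subset_type 2 H -> g \notin H.
Proof.
move=> /Syl_triplesP sylv /fixers5P[/fixersP[_ gs _ _] vx ntx] [t ot fixt].
apply/negP=> Hg; have := order5_set (O := t o0) (sylv o0) vx ntx.
rewrite ot => /(_ isT)/negP[]; rewrite -astab1_set; apply/astab1P.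
by have [] := triple_fix_rot gs (subsetP fixt g Hg).
Qed.

Section LowerBound.
Context (C : {set {group W}}).
Context (prC : forall H : {group W}, H \in C -> H \proper G).
Context (covC : forall g, g \in G -> exists2 H : {group W}, H \in C & g \in H).

(** The members that contain the elements of [pair_witness]; uniqueness of the
    triple fixed by such an element makes them distinct. *)
Lemma pair_members : exists C1 : {set {group W}},
  [/\ C1 \subset C, #|C1| = 1000 & forall H, H \in C1 -> subset_type 2 H].
Proof.
(* H contains an element that fixes t and no other triple of 2-subsets. *)
pose w (t : {ffun 'I_3 -> {set 'I_5}}) (H : {group W}) :=
  [&& H \in C, fixes H t subset_act
    & [exists g in H, forall t' in subset_triples 2,
         (g \in 'C[t' | triple_act subset_act]) ==> (t' == t)]].
have exw t : t \in subset_triples 2 -> exists H, w t H.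
  move/subset_triplesP/pair_witness=> [g [Gg fixg uniqg]].
  have [H CH Hg] := covC Gg; exists H; apply/and3P; split=> //.
    exact: fixg (prC CH) Hg.
  apply/exists_inP; exists g => //; apply/forall_inP=> t' /subset_triplesP ot'.
  by apply/implyP=> /(uniqg t' ot')/eqP.
pose f t := odflt 1%G [pick H | w t H].
have fw t : t \in subset_triples 2 -> w t (f t).
  by move=> /exw[H wH]; rewrite /f; case: pickP => [// | /(_ H)]; rewrite wH.
exists (f @: subset_triples 2); split.
- by apply/subsetP=> _ /imsetP[t /fw/and3P[Cf _ _] ->].
- rewrite card_in_imset ?card_subset_triples // => t t' Tt Tt' eq_f.
  have /and3P[_ _ /exists_inP[g fg /forall_inP uniqg]] := fw t Tt.
  have /and3P[_ fixt' _] := fw t' Tt'; rewrite -eq_f in fixt'.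
  by have /implyP/(_ (subsetP fixt' g fg))/eqP := uniqg t' Tt'.
- move=> _ /imsetP[t Tt ->]; have /and3P[_ fixt _] := fw t Tt.
  by exists t => //; apply/subset_triplesP.
Qed.

(** Outside the 1000 members of [pair_members], let R2 be the set of those
    that contain an odd rotating element fixing a Sylow triple.  The member
    that contains [u0] is not in R2, and has no even rotating element either,
    since the product of such an element with [u0] would be odd and rotating.
    If it were the only member outside R2, then R2 would have exactly 125
    members and would cover the elements of [fixers5]. *)
Lemma cover_bound : 1127 <= #|C|.
Proof.
have [C1 [sC1 oC1 pairC1]] := pair_members.
pose R := C :\: C1.
have -> : #|C| = (1000 + #|R|)%N by rewrite -oC1 -(cardsID C1 C) (setIidPr sC1).
rewrite -[1127]/(1000 + 127)%N leq_add2l leqNgt; apply/negP=> ltR.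
have coverR g : g \in G -> (forall H : {group W}, subset_type 2 H -> g \notin H) ->
    exists2 H : {group W}, H \in R & g \in H.
  move=> Gg nog; have [H CH Hg] := covC Gg; exists H => //.
  by rewrite inE CH andbT; apply: contraL Hg => /pairC1; apply: nog.
pose meets (H : {group W}) := [exists v in Syl_triples, [exists g in H, g \in fixers true v]].
pose R2 := [set H in R | meets H].
have sRC (H : {group W}) : H \in R -> H \proper G by case/setDP=> /prC.
have prR2 (H : {group W}) : H \in R2 -> H \proper G by case/setIdP=> /sRC.
have meetR2 (H : {group W}) : H \in R2 ->
    exists2 v, v \in Syl_triples & exists2 g, g \in H & g \in fixers true v.
  by case/setIdP=> _ /exists_inP[v Tv /exists_inP[g Hg fixg]]; exists v => //; exists g.
have odd_mem v g : v \in Syl_triples -> g \in fixers true v ->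
    exists2 H : {group W}, H \in R2 & g \in H.
  move=> Tv fixg; have [Gg _ _ _] := fixersP _ _ _ fixg.
  have [H RH Hg] := coverR g Gg (fun H => @fixers_pair_type H v g Tv fixg).
  exists H => //; rewrite inE RH /=; apply/exists_inP; exists v => //.
  by apply/exists_inP; exists g.
have R2_125 := odd_cover_bound prR2 meetR2 odd_mem.
have [Hu RHu Hu0] := coverR u0 u0_G u0_pair_type.
have no_odd g : g \in Hu -> top g = rot3 -> parity g -> False.
  by move=> Hg gs pg; have := u0_type (sRC _ RHu) Hg gs pg; rewrite Hu0.
have nR2Hu : Hu \notin R2.
  apply/negP=> /meetR2[v _ [g Hg /fixersP[_ gs pg _]]].
  exact: no_odd Hg gs pg.
have sR2 : R2 \subset R :\ Hu.
  apply/subsetP=> H R2H; rewrite !inE; have /setIdP[RH _] := R2H.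
  by move: RH; rewrite inE => ->; rewrite andbT; apply: contraNneq nR2Hu => <-.
have oRHu : #|R| = #|R :\ Hu|.+1 by rewrite (cardsD1 Hu) RHu.
have eqR2 : R2 = R :\ Hu.
  by apply/eqP; rewrite eqEcard sR2; move: ltR R2_125; rewrite oRHu; lia.
have even_mem v g : v \in Syl_triples -> g \in fixers5 v ->
    exists2 H : {group W}, H \in R2 & g \in H.
  move=> Tv fixg; have /fixers5P[/fixersP[Gg gs pg _] _ _] := fixg.
  have [H RH Hg] := coverR g Gg (fun H => @fixers5_pair_type H v g Tv fixg).
  exists H => //; rewrite eqR2; apply/setD1P; split=> //.
  apply: contraTneq isT => eqH; rewrite eqH in Hg; case: (@no_odd (g * u0)).
  - by rewrite groupM.
  - by rewrite topM gs mulg1.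
  - rewrite /parity coordM invg1 perm1 odd_permM -/(parity g) pg coord_wreath_elt /=.
    by rewrite odd_y4.
have := even_cover_bound prR2 meetR2 even_mem.
by rewrite eqR2; move: ltR; rewrite oRHu; lia.
Qed.
End LowerBound.

(** * A cover with 1127 members *)

Definition even_set : {set W} := [set u | [forall i, ~~ odd_perm (coord u i)]].
Lemma even_group_set : group_set even_set.
Proof.
apply/group_setP; split=> [|u v]; rewrite !inE.
  by apply/forallP=> i; rewrite coord1 odd_perm1.
move=> /forallP eu /forallP ev; apply/forallP=> i.
by rewrite coordM odd_permM (negPf (eu _)) (negPf (ev _)).
Qed.
Canonical even_group := Group even_group_set.

Definition subset_stabiliser (t : {ffun 'I_3 -> {set 'I_5}}) :=
  (G :&: 'C[t | triple_act subset_act])%G.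

Definition small_cover : {set {group W}} :=
  [set (G :&: base)%G; (G :&: even_group)%G]
    :|: (subset_stabiliser @: subset_triples 1%N :|: subset_stabiliser @: subset_triples 2).

Lemma card_small_cover : #|small_cover| <= 1127.
Proof.
apply: leq_trans (leq_card_setU _ _) _; rewrite -[1127]/(2 + (125 + 1000))%N.
apply: leq_add; first by rewrite cards2; case: (_ != _).
apply: leq_trans (leq_card_setU _ _) _.
have leS n : #|subset_stabiliser @: subset_triples n| <= 'C(5, n) ^ 3.
  by rewrite -card_subset_triples leq_imset_card.
exact: leq_add (leS 1%N) (leS 2).
Qed.

(** A Sylow 5-subgroup of S5 is transitive, so that one of its elements, taken
    as all three coordinates, moves the triple. *)
Lemma subset_stabiliser_proper n t :
  0 < n < 5 -> t \in subset_triples n -> subset_stabiliser t \proper G.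
Proof.
move=> n5 /subset_triplesP ot; rewrite properE subsetIl /=.
have [P sylP] : exists P, P \in Syl5 by apply/set0Pn; rewrite -card_gt0 card_Syl6.
have := Syl_moves_set (O := t o0) sylP; rewrite ot => /(_ n5)/subsetPn[p Pp np].
apply/subsetPn; exists (wreath_elt 1 (fun=> p)).
  by apply/mem_A5cube6P; split=> [|i]; [apply: group1 | rewrite /parity !coord_wreath_elt].
apply: contra np => /setIP[_ /triple_fixP/(_ o0)].
by rewrite top_wreath_elt perm1 coord_wreath_elt -astab1_set => /= t0; apply/astab1P.
Qed.

(** The return of [g] is odd, so it fixes a point or a 2-subset, and
    [triple_fix] for the cyclic group of [g] extends this to a triple. *)
Lemma odd_in_stabiliser g : g \in G -> top g = rot3 -> parity g ->
  exists2 t, (t \in subset_triples 1%N) || (t \in subset_triples 2)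
    & g \in subset_stabiliser t.
Proof.
move=> Gg gs pg; have g3 := top_cube gs.
have Bg3 : g ^+ 3 \in base by apply/baseP.
have [] := @odd_fixes_small (coord (g ^+ 3) o0).
  by have /mem_A5cube6P[_ e] := Gg; rewrite coord_cube // !odd_permM !e pg.
move=> O oO; rewrite -astab1_set => /astab1P fixO.
have sgG : <[g]> \subset G by rewrite cycle_subG.
have [|t [_ tO fixt]] := triple_fix (y := O) (to := subset_act) sgG (cycle_id g) gs.
  move=> _ /cycleP[m ->] gm1; have [j ->] : exists j, m = (3 * j)%N.
    have : rot3 ^+ m = 1 by rewrite -gm1; elim: m {gm1} => // m IHm; rewrite !expgS topM IHm gs.
    move/eqP; rewrite -order_dvdn order_rot3 => /dvdnP[j ->].
    by exists j; rewrite mulnC.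
  rewrite expgM coordX //; apply/astab1P; rewrite groupX //.
  exact/astab1P.
have ot i : #|t i| = #|O|.
  by have [a ->] := tO i; rewrite /= setactE card_imset //; apply: act_inj.
exists t; last by rewrite inE Gg; apply: (subsetP fixt); apply: cycle_id.
by case/orP: oO => /eqP oO; apply/orP; [left | right];
  apply/subset_triplesP=> i; rewrite ot.
Qed.

(** An odd element whose top component is the inverse of [rot3] is handled
    through its inverse. *)
Lemma small_coverP : is_cover G small_cover.
Proof.
have gs : top g0 = rot3 by [].
apply/andP; split.
  apply/'forall_implyP => H; rewrite !inE => /orP[/orP[]/eqP-> | /orP[]/imsetP[t Tt ->]].
  - rewrite properE subsetIl /=; apply/subsetPn; exists g0; first exact: g0_G.
    by apply/negP=> /setIP[_ /baseP]; rewrite gs => /eqP; apply/negP/rot3_neq1.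
  - rewrite properE subsetIl /=; apply/subsetPn; exists g0; first exact: g0_G.
    apply/negP=> /setIP[_]; rewrite inE => /forallP/(_ o0).
    by rewrite -/(parity g0) parity_g0.
  - exact: subset_stabiliser_proper Tt.
  - exact: subset_stabiliser_proper Tt.
rewrite eqEsubset; apply/andP; split.
  apply/bigcupsP=> H; rewrite !inE => /orP[/orP[]/eqP-> | /orP[]/imsetP[t _ ->]];
    exact: subsetIl.
apply/subsetP=> g Gg; have /mem_A5cube6P[/Alt3P top_g odd_g] := Gg.
have [pg | even_g] := boolP (parity g); last first.
  apply/bigcupP; exists (G :&: even_group)%G; first by rewrite !inE eqxx ?orbT.
  by rewrite inE Gg inE; apply/forallP=> i; rewrite odd_g.
have stab_cover t : (t \in subset_triples 1%N) || (t \in subset_triples 2) ->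
    g \in subset_stabiliser t -> g \in \bigcup_(H in small_cover) H.
  move=> Tt fixg; apply/bigcupP; exists (subset_stabiliser t) => //.
  by apply/setUP; right; apply/setUP; case/orP: Tt => Tt; [left | right];
    apply: imset_f.
case: top_g => top_g.
- apply/bigcupP; exists (G :&: base)%G; first by rewrite !inE eqxx ?orbT.
  by rewrite inE Gg; apply/baseP.
- by have [t] := odd_in_stabiliser Gg top_g pg; apply: stab_cover.
have [||| t Tt fixt] := @odd_in_stabiliser g^-1.
- by rewrite groupV.
- by rewrite topV top_g invgK.
- by rewrite /parity coordV odd_permV odd_g.
- by apply: (stab_cover t) => //; rewrite -groupV.
Qed.

Theorem mainTheorem4 : covering_number A5cube6 = 1127.
Proof.
have lower C : is_cover G C -> 1127 <= #|C|.
  case/andP=> /'forall_implyP prC /eqP covC; apply: cover_bound => // g.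
  by rewrite -covC => /bigcupP[H CH Hg]; exists H.
apply/covering_numberP => //; split=> //; exists small_cover; first exact: small_coverP.
by apply/eqP; rewrite eqn_leq card_small_cover lower ?small_coverP.
Qed.
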